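(* Let $\psi\in\mathrm{Skew}$. Then the following two conditions are equivalent: (i) $\psi\in\mathfrak{dmr}_0$; (ii) $\psi\in\mathfrak{rc}_0$ and, for all indices $\mathbf a=(a_1,\dots,a_k)$, $\mathbf b=(b_1,\dots,b_l)$ with $l\ge2$ and $(\mathbf a,\mathbf b)\ne((1,\dots,1),(1,\dots,1))$ (i.e. the entries of $\mathbf a$ and $\mathbf b$ are not all equal to $1$), $$l^{y,x}_{(a_1,\dots,a_k),(b_1,\dots,b_l)}(\psi_{451}+\psi_{123})=l^{y,x}_{(a_1,\dots,a_k,b_1),(b_2,\dots,b_l)}(\psi_{451}+\psi_{123}).$$
   Context: Let $k$ be a field of characteristic zero, $A=k\langle\langle x_0,x_1\rangle\rangle$ the algebra of noncommutative formal power series with counit $\varepsilon$ (constant term), $c_w(\varphi)$ the coefficient of the word $w$ in $\varphi\in A$, and $\mathfrak{fr}_k(x_0,x_1)\subset A$ the (completed) free Lie algebra of formal Lie series. $\mathfrak{fr}^{>1}_k(x_0,x_1)$ is the set of $\psi\in\mathfrak{fr}_k(x_0,x_1)$ with $\psi(x_0,0)=\psi(0,x_1)=0$, and $\mathrm{Skew}=\{\psi\in\mathfrak{fr}^{>1}_k(x_0,x_1)\mid\psi(x_0,x_1)=-\psi(x_1,x_0)\}$. Double shuffle Lie algebra. $\mathfrak{dmr}_0$ is the set of $\psi\in\mathfrak{fr}_k(x_0,x_1)$ with $c_{x_0}(\psi)=c_{x_1}(\psi)=c_{x_0x_1}(\psi)=0$ and $\Delta_*(\psi_* )=1\otimes\psi_*+\psi_*\otimes1$,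 where $\psi_*=\psi_{\mathrm{corr}}+\pi_Y(\psi)\in k\langle\langle y_1,y_2,\dots\rangle\rangle$, $\psi_{\mathrm{corr}}=\sum_{n\ge1}\frac{(-1)^n}{n}c_{x_0^{n-1}x_1}(\psi)\,y_1^n$, $\pi_Y$ is the $k$-linear map sending words ending in $x_0$ to $0$ and $x_0^{n_m-1}x_1\cdots x_0^{n_1-1}x_1$ to $(-1)^m y_{n_m}\cdots y_{n_1}$, and $\Delta_*$ is the coproduct (algebra morphism) with $\Delta_*y_n=\sum_{i=0}^n y_i\otimes y_{n-i}$, $y_0=1$. Reduced coaction. Every $\varphi\in A$ is uniquely written $\varphi=\varepsilon(\varphi)+x_0d^R_0(\varphi)+x_1d^R_1(\varphi)=\varepsilon(\varphi)+d^L_0(\varphi)x_0+d^L_1(\varphi)x_1$. The reduced coaction $\mu:A\to A$ is the (continuous) linear map with $\mu(x_0)=\mu(x_1)=0$ and $\mu(k_1\cdots k_n)=\sum_{i=1}^{n-1}k_1\cdots k_{i-1}(k_i\odot k_{i+1})k_{i+2}\cdots k_n$ for letters $k_j\in\{x_0,x_1\}$, where $x_i\odot x_j=\delta_{ij}x_i$. For a Lie series $\eta$ with $c_{x_0}(\eta)=c_{x_1}(\eta)=0$ let $r_\eta(x)=\sum_{l\ge0}c_{x_0^{l+1}x_1}(\eta)x^{l+1}$. The reduced coaction equation for $\eta$ is $\mu(\eta)=-r_\eta(x_1)+r_\eta(-x_0)-d^L_0(\eta)-d^R_1(\eta)$. $\mathfrak{rc}$ is the set of $\psi\in\mathrm{Skew}$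 satisfying this equation, and $\mathfrak{rc}_0\subset\mathfrak{rc}$ is the subset of elements whose coefficient of the commutator $[x_0,x_1]$ is $0$. $\mathfrak p_5$ is the (degree-completed) Lie algebra over $k$ with generators $x_{ij}=x_{ji}$ ($1\le i,j\le5$) and relations $x_{ii}=0$, $\sum_{j=1}^5x_{ij}=0$ for all $i$, and $[x_{ij},x_{kl}]=0$ if $\{i,j\}\cap\{k,l\}=\emptyset$. Write $\psi_{ijk}:=\psi(x_{ij},x_{jk})\in\mathfrak p_5$. Polylogarithmic functionals. An index is a tuple $\mathbf a=(a_1,\dots,a_k)$, $k\ge1$, of positive integers; its depth is $k$. The degree-one part of $\mathfrak p_5$ has basis $x_{45},x_{34},x_{24},x_{12},x_{23}$; let $\omega_{45},\omega_{34},\omega_{24},\omega_{12},\omega_{23}$ be the dual basis (corresponding to $\frac{dy}{y},\frac{dy}{y-1},\frac{d(xy)}{xy-1},\frac{dx}{x},\frac{dx}{x-1}$). The word $[\omega_{i_m}|\cdots|\omega_{i_1}]$ (multilinear in its entries) is the functional extracting the coefficient of $x_{i_m}\cdots x_{i_1}$ from a noncommutative series in these five generators; combinations of words satisfying Chen's integrability condition descend to functionals on the completed $U\mathfrak p_5$. The following combinations are integrable. For $\mathbf a=(a_1,\dots,a_k)$ put $l^{y}_{\mathbf a}=(-1)^k[\omega_{45}^{a_k-1}|\omega_{34}|\cdots|\omega_{45}^{a_1-1}|\omega_{34}]$ and $l^{xy}_{\mathbf a}=(-1)^k[(\omega_{12}+\omega_{45})^{a_k-1}|\omega_{24}|\cdots|(\omega_{12}+\omega_{45})^{a_1-1}|\omega_{24}]$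 (powers denote repeated tensor entries). With the conventions $l^{x,y}_{\emptyset,\mathbf b}:=l^y_{\mathbf b}$ and $l^{x,y}_{\mathbf a,\emptyset}:=l^{xy}_{\mathbf a}$, define recursively, for $\mathbf a=(a_1,\dots,a_k)$, $\mathbf b=(b_1,\dots,b_l)$, $k,l\ge1$: $l^{x,y}_{\mathbf a,\mathbf b}=X+Y$, where $X=[\omega_{12}|l^{x,y}_{(a_1,\dots,a_{k-1},a_k-1),\mathbf b}]$ if $a_k\ne1$, and $X=-[\omega_{23}|l^{x,y}_{(a_1,\dots,a_{k-1}),\mathbf b}]-[\omega_{12}-\omega_{23}|l^{x,y}_{(a_1,\dots,a_{k-1},b_1),(b_2,\dots,b_l)}]$ if $a_k=1$; $Y=[\omega_{45}|l^{x,y}_{\mathbf a,(b_1,\dots,b_{l-1},b_l-1)}]$ if $b_l\ne1$, and $Y=-[\omega_{34}|l^{x,y}_{\mathbf a,(b_1,\dots,b_{l-1})}]$ if $b_l=1$. (This is the bar-construction element of the iterated integral $\mathrm{Li}_{\mathbf a,\mathbf b}(x,y)=\sum_{0<m_1<\dots<m_k<n_1<\dots<n_l}\frac{x^{m_k}y^{n_l}}{m_1^{a_1}\cdots m_k^{a_k}n_1^{b_1}\cdots n_l^{b_l}}$.) Finally $l^{y,x}_{\mathbf a,\mathbf b}$ (corresponding to $\mathrm{Li}_{\mathbf a,\mathbf b}(y,x)$) is obtained from $l^{x,y}_{\mathbf a,\mathbf b}$ by exchanging $\omega_{12}\leftrightarrow\omega_{45}$ and $\omega_{23}\leftrightarrow\omega_{34}$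 and fixing $\omega_{24}$. *)

(* Defs.v *)
From HB Require Import structures.
From mathcomp Require Import all_boot all_order all_algebra.
From mathcomp Require Import zify ring boolp.

Set Implicit Arguments.
Unset Strict Implicit.
Unset Printing Implicit Defensive.

Import GRing.Theory.
Local Open Scope ring_scope.
Local Open Scope quotient_scope.

(* The noncommutative formal power series k<<X>>, given by their coefficients:
   f w is the coefficient c_w(f). *)
Record ncps (X : eqType) (k : fieldType) := NCps { ncoef :> seq X -> k }.

Section Ring.
Variables (X : eqType) (k : fieldType).
Implicit Types (f g h : ncps X k) (w : seq X).
Local Notation ncps := (ncps X k).

Lemma ncpsP f g : f =1 g <-> f = g.
Proof.
split=> [|->//]; case: f g => [f] [g] /= fg.
by congr NCps; apply/funext.
Qed.

HB.instance Definition _ := gen_eqMixin ncps.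
HB.instance Definition _ := gen_choiceMixin ncps.

Definition nc0 : ncps := NCps (fun _ => 0).
Definition ncadd f g : ncps := NCps (fun w => f w + g w).
Definition ncopp f : ncps := NCps (fun w => - f w).

Fact ncaddA : associative ncadd.
Proof. by move=> f g h; apply/ncpsP => w /=; rewrite addrA. Qed.
Fact ncaddC : commutative ncadd.
Proof. by move=> f g; apply/ncpsP => w /=; rewrite addrC. Qed.
Fact ncadd0 : left_id nc0 ncadd.
Proof. by move=> f; apply/ncpsP => w /=; rewrite add0r. Qed.
Fact ncaddN : left_inverse nc0 ncopp ncadd.
Proof. by move=> f; apply/ncpsP => w /=; rewrite addNr. Qed.

HB.instance Definition _ :=
  GRing.isZmodule.Build ncps ncaddA ncaddC ncadd0 ncaddN.

Definition ncword (u : seq X) : ncps := NCps (fun w => (w == u)%:R).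
Definition ncvar (x : X) : ncps := ncword [:: x].

Definition ncmul f g : ncps :=
  NCps (fun w => \sum_(i < (size w).+1) f (take i w) * g (drop i w)).

(* f = f [::] + \sum_x x * ncder x f, see nc_decomp. *)
Definition ncder (x : X) f : ncps := NCps (fun w => f (x :: w)).

Lemma ncmul_nil f g : ncmul f g [::] = f [::] * g [::].
Proof. by rewrite /= big_ord_recl big_ord0 addr0. Qed.

Lemma ncmul_cons f g x w :
  ncmul f g (x :: w) = f [::] * g (x :: w) + ncmul (ncder x f) g w.
Proof. by rewrite /= big_ord_recl /=. Qed.

Fact ncmulDl : left_distributive ncmul +%R.
Proof.
move=> f g h; apply/ncpsP => w /=.
by rewrite -big_split; apply: eq_bigr => i _; rewrite mulrDl.
Qed.

Fact ncmulDr : right_distributive ncmul +%R.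
Proof.
move=> f g h; apply/ncpsP => w /=.
by rewrite -big_split; apply: eq_bigr => i _; rewrite mulrDr.
Qed.

Fact ncmulA : associative ncmul.
Proof.
move=> f g h; apply/ncpsP => w; elim: w f g h => [|x w IH] f g h.
  by rewrite !ncmul_nil mulrA.
rewrite !ncmul_cons mulrDr ncmul_nil mulrA -addrA; congr (_ + _).
have -> : ncder x (ncmul f g) =
    NCps (fun w => f [::] * ncder x g w) + ncmul (ncder x f) g.
  by apply/ncpsP => v; rewrite [LHS]ncmul_cons.
rewrite ncmulDl [RHS]/= -/(ncmul _ _ w) IH; congr (_ + _).
by rewrite /= mulr_sumr; apply: eq_bigr => i _ /=; rewrite mulrA.
Qed.

Fact ncmul1 : left_id (ncword [::]) ncmul.
Proof.
move=> f; apply/ncpsP => w /=; rewrite big_ord_recl take0 drop0 eqxx mul1r.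
rewrite big1 ?addr0 // => i _; rewrite -size_eq0 size_take /=.
by case: (size w) i => [|n] i; [case: i | case: ifP => _; rewrite mul0r].
Qed.

Fact ncmulr1 : right_id (ncword [::]) ncmul.
Proof.
move=> f; apply/ncpsP => w /=.
rewrite big_ord_recr /= take_size drop_size eqxx mulr1.
rewrite big1 ?add0r // => i _; rewrite -size_eq0 size_drop subn_eq0.
by rewrite leqNgt ltn_ord mulr0.
Qed.

Fact nc1_neq0 : ncword [::] != 0.
Proof. by apply/eqP => /ncpsP/(_ [::])/eqP; rewrite /= oner_eq0. Qed.

HB.instance Definition _ := GRing.Zmodule_isNzRing.Build ncps
  ncmulA ncmul1 ncmulr1 ncmulDl ncmulDr nc1_neq0.

Definition ncscale (c : k) f : ncps := NCps (fun w => c * f w).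

Fact ncscaleA a b f : ncscale a (ncscale b f) = ncscale (a * b) f.
Proof. by apply/ncpsP => w /=; rewrite mulrA. Qed.
Fact ncscale1 : left_id 1 ncscale.
Proof. by move=> f; apply/ncpsP => w /=; rewrite mul1r. Qed.
Fact ncscaleDr : right_distributive ncscale +%R.
Proof. by move=> a f g; apply/ncpsP => w /=; rewrite mulrDr. Qed.
Fact ncscaleDl f : {morph ncscale^~ f : a b / a + b}.
Proof. by move=> a b; apply/ncpsP => w /=; rewrite mulrDl. Qed.

HB.instance Definition _ := GRing.Zmodule_isLmodule.Build k ncps
  ncscaleA ncscale1 ncscaleDr ncscaleDl.

Fact ncscaleAl (a : k) f g : a *: (f * g) = a *: f * g.
Proof.
apply/ncpsP => w /=; rewrite mulr_sumr; apply: eq_bigr => i _ /=.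
by rewrite mulrA.
Qed.
HB.instance Definition _ := GRing.Lmodule_isLalgebra.Build k ncps ncscaleAl.

Fact ncscaleAr (a : k) f g : a *: (f * g) = f * (a *: g).
Proof.
apply/ncpsP => w /=; rewrite mulr_sumr; apply: eq_bigr => i _ /=.
by rewrite mulrCA.
Qed.
HB.instance Definition _ := GRing.Lalgebra_isAlgebra.Build k ncps ncscaleAr.

Lemma ncDE f g w : (f + g) w = f w + g w. Proof. by []. Qed.
Lemma ncNE f w : (- f) w = - f w. Proof. by []. Qed.
Lemma ncBE f g w : (f - g) w = f w - g w. Proof. by []. Qed.
Lemma nc0E w : (0 : ncps) w = 0. Proof. by []. Qed.
Lemma nc1E w : (1 : ncps) w = (w == [::])%:R. Proof. by []. Qed.
Lemma ncZE c f w : (c *: f) w = c * f w. Proof. by []. Qed.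
Lemma ncME f g w :
  (f * g) w = \sum_(i < (size w).+1) f (take i w) * g (drop i w).
Proof. by []. Qed.
Lemma ncM_nil f g : (f * g) [::] = f [::] * g [::].
Proof. exact: ncmul_nil. Qed.
Lemma ncM_cons f g x w :
  (f * g) (x :: w) = f [::] * g (x :: w) + (ncder x f * g) w.
Proof. exact: ncmul_cons. Qed.
Lemma ncwordE u w : ncword u w = (w == u)%:R. Proof. by []. Qed.

Lemma ncder_var x y : ncder x (ncvar y) = (x == y)%:R *: 1.
Proof.
apply/ncpsP => w; rewrite ncZE nc1E /= eqseq_cons.
by case: (x == y); rewrite ?mul0r ?mul1r.
Qed.

Lemma ncvarM_nil x f : (ncvar x * f) [::] = 0.
Proof. by rewrite ncM_nil mul0r. Qed.

Lemma ncvarM_cons x y f w : (ncvar x * f) (y :: w) = (y == x)%:R * f w.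
Proof. by rewrite ncM_cons mul0r add0r ncder_var -scalerAl mul1r. Qed.

Lemma ncMvar_rcons x y f w : (f * ncvar x) (rcons w y) = (y == x)%:R * f w.
Proof.
rewrite ncME -cats1 size_cat addn1 2!big_ord_recr /=.
rewrite take_size_cat // drop_size_cat // [drop _.+1 _]drop_oversize; last first.
  by rewrite size_cat addn1.
rewrite mulr0 addr0 eqseq_cons andbT.
rewrite mulrC -[RHS]add0r; congr (_ + _); apply: big1 => j _.
suff /negbTE-> : drop j (w ++ [:: y]) != [:: x] by rewrite mulr0.
apply/eqP => /(congr1 size); rewrite size_drop size_cat /= addn1.
by have := ltn_ord j; lia.
Qed.

Definition ncbr f g : ncps := f * g - g * f.

Definition nchom (n : nat) f : ncps :=
  NCps (fun w => if size w == n then f w else 0).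

Inductive lie_poly : ncps -> Prop :=
| LieVar x : lie_poly (ncvar x)
| LieAdd f g : lie_poly f -> lie_poly g -> lie_poly (f + g)
| LieScale c f : lie_poly f -> lie_poly (c *: f)
| LieBr f g : lie_poly f -> lie_poly g -> lie_poly (ncbr f g).

Definition lie_series f : Prop := forall n, lie_poly (nchom n f).

End Ring.

Section Substitution.
Variables (X : finType) (Y : eqType) (k : fieldType).

(* Continuous linear extension of a map F on words, for F such that F u only
   involves words of length at least |u| - d: then the words u with
   |u| > |w| + d do not contribute to the coefficient of w. *)
Definition ncext (d : nat) (F : seq X -> ncps Y k) (f : ncps X k) : ncps Y k :=
  NCps (fun w => \sum_(n < (size w + d).+1) \sum_(u : n.-tuple X)
                   f u * F u w).

(* Substitution of the series s x, without constant term, for the letters x. *)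
Definition ncsubst (s : X -> ncps Y k) : ncps X k -> ncps Y k :=
  ncext 0 (fun u => \prod_(x <- u) s x).

End Substitution.

(* The letters x_0 and x_1 are false and true. *)
Local Notation l0 := false (only parsing).
Local Notation l1 := true (only parsing).

Section SkewSeries.
Variables (k : fieldType).
Local Notation A := (ncps bool k).
Implicit Types psi eta phi : A.

Definition X0 : A := ncvar k l0.
Definition X1 : A := ncvar k l1.

(* psi(a, b) *)
Definition ev2 (Y : eqType) psi (a b : ncps Y k) : ncps Y k :=
  ncsubst (fun x : bool => if x then b else a) psi.

Definition fr_gt1 psi : Prop :=
  [/\ lie_series psi, ev2 psi X0 0 = 0 & ev2 psi 0 X1 = 0].

Definition Skew psi : Prop := fr_gt1 psi /\ psi = - ev2 psi X1 X0.

End SkewSeries.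

Section DoubleShuffle.
Variable k : fieldType.
Local Notation A := (ncps bool k).
Implicit Types psi : A.

(* The word x_0^(n-1) x_1, for n >= 1. *)
Definition zword (n : nat) : seq bool := rcons (nseq n.-1 l0) l1.

(* k<<y_1, y_2, ..>>: the letter n : nat stands for y_(n+1). *)
Local Notation B := (ncps nat k).

(* y_n, with y_0 = 1 *)
Definition yser (n : nat) : B := if n is n'.+1 then ncvar k n' else 1.

(* pi_Y is injective on the words it does not kill, whence its coefficients. *)
Definition piY psi : B :=
  NCps (fun v => (-1) ^+ size v * psi (flatten [seq zword n.+1 | n <- v])).

Definition psi_corr psi : B :=
  NCps (fun v => let n := size v in
    if (0 < n)%N && (v == nseq n 0%N)
    then (-1) ^+ n / n%:R * psi (zword n) else 0).

Definition psi_star psi : B := psi_corr psi + piY psi.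

(* The completed tensor square of k<<y_1, y_2, ..>>: the value at u, v is the
   coefficient of u (x) v. *)
Definition nctens := seq nat -> seq nat -> k.

Definition tens (f g : B) : nctens := fun u v => f u * g v.

Definition tens_mul (s t : nctens) : nctens := fun u v =>
  \sum_(i < (size u).+1) \sum_(j < (size v).+1)
     s (take i u) (take j v) * t (drop i u) (drop j v).

Definition delta_y (n : nat) : nctens := fun u v =>
  \sum_(i < n.+1) tens (yser i) (yser (n - i)) u v.

Definition delta_word (w : seq nat) : nctens :=
  foldr tens_mul (tens 1 1) [seq delta_y n.+1 | n <- w].

(* Delta_* preserves the weight (y_n has weight n), so only words of weight N,
   hence of length at most N and with letters among y_1, .., y_N, contribute to
   the coefficient of u (x) v. *)
Definition delta_star (f : B) : nctens := fun u v =>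
  let N := (\sum_(n <- u ++ v) n.+1)%N in
  \sum_(m < N.+1) \sum_(w : m.-tuple 'I_N)
     f [seq val i | i <- w] * delta_word [seq val i | i <- w] u v.

Definition dmr0 psi : Prop :=
  [/\ lie_series psi,
      [/\ psi [:: l0] = 0, psi [:: l1] = 0 & psi [:: l0; l1] = 0]
    & forall u v, delta_star (psi_star psi) u v =
                  tens 1 (psi_star psi) u v + tens (psi_star psi) 1 u v].

End DoubleShuffle.

Section ReducedCoaction.
Variable k : fieldType.
Local Notation A := (ncps bool k).
Implicit Types psi eta phi : A.

Definition dR (i : bool) phi : A := NCps (fun w => phi (i :: w)).
Definition dL (i : bool) phi : A := NCps (fun w => phi (rcons w i)).

Lemma dR_decomp phi :
  phi = phi [::] *: 1 + X0 k * dR l0 phi + X1 k * dR l1 phi.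
Proof.
apply/ncpsP => -[|x w]; rewrite !ncDE ncZE nc1E ?ncvarM_nil ?ncvarM_cons.
  by rewrite !addr0 mulr1.
by case: x; rewrite ?(mulr0, mul0r, mul1r, add0r, addr0).
Qed.

Lemma dL_decomp phi :
  phi = phi [::] *: 1 + dL l0 phi * X0 k + dL l1 phi * X1 k.
Proof.
apply/ncpsP => w; case/lastP: w => [|w x].
  by rewrite !ncDE ncZE nc1E !ncM_nil !mulr0 !addr0 mulr1.
rewrite !ncDE ncZE nc1E !ncMvar_rcons -size_eq0 size_rcons.
by case: x; rewrite ?(mulr0, mul0r, mul1r, add0r, addr0).
Qed.

Definition odot (i j : bool) : A := if i == j then ncvar k i else 0.

Definition mu_word (u : seq bool) : A :=
  \sum_(i < (size u).-1)
     ncword k (take i u) * odot (nth l0 u i) (nth l0 u i.+1)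
       * ncword k (drop i.+2 u).

Definition mu : A -> A := ncext 1 mu_word.

(* r_eta(s), for s without constant term: s ^+ l.+1 only involves words of
   length at least l.+1. *)
Definition r_ser eta (s : A) : A :=
  NCps (fun w => \sum_(l < size w) eta (zword l.+2) * (s ^+ l.+1) w).

Definition rc_eq eta : Prop :=
  mu eta = - r_ser eta (X1 k) + r_ser eta (- X0 k) - dL l0 eta - dR l1 eta.

Definition rc psi : Prop := Skew psi /\ rc_eq psi.

(* The coefficient of [x_0, x_1] in a Lie series. *)
Definition comm_coef psi : k := psi [:: l0; l1].

Lemma comm_coefP psi : lie_series psi ->
  nchom 2 psi = comm_coef psi *: ncbr (X0 k) (X1 k).
Proof.
have mul2 (f g : A) a b : f [::] = 0 -> g [::] = 0 ->
    (f * g) [:: a; b] = f [:: a] * g [:: b].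
  move=> f0 g0; rewrite ncME !big_ord_recl big_ord0 /=.
  by rewrite f0 g0 mul0r mulr0 !addr0 add0r.
have br2 a b : ncbr (X0 k) (X1 k) [:: a; b] = b%:R - a%:R.
  rewrite ncBE !mul2 // !ncwordE !eqseq_cons !andbT.
  by case: a b => [] []; rewrite /= ?(mulr0, mulr1, mul0r, subrr).
have key (f : A) : lie_poly f -> f [::] = 0 /\ forall a b,
    f [:: a; b] = f [:: l0; l1] * ncbr (X0 k) (X1 k) [:: a; b].
  elim=> {f} [x|f g _ [f0 f2] _ [g0 g2]|c f _ [f0 f2]|f g _ [f0 f2] _ [g0 g2]].
  - by split=> // a b; rewrite !ncwordE !eqseq_cons !andbF mul0r.
  - by split=> [|a b]; rewrite !ncDE ?f0 ?g0 ?addr0 // f2 g2 -mulrDl.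
  - by split=> [|a b]; rewrite !ncZE ?f0 ?mulr0 // f2 -mulrA.
  split=> [|a b]; first by rewrite ncBE !ncM_nil f0 g0 mul0r subrr.
  rewrite br2 !ncBE !mul2 //.
  case: a b => [] [];
    rewrite ?(subrr, subr0, sub0r, mulr0, mulr1, mulrN, opprB) //.
  - by rewrite mulrC subrr.
  - by rewrite [_ * f _]mulrC [g _ * _]mulrC.
  - by rewrite mulrC subrr.
move=> /(_ 2%N)/key[_ H]; apply/ncpsP => -[|a [|b [|c w]]]; last first.
- rewrite ncZE ncBE !ncvarM_cons !ncwordE !eqseq_cons !andbF.
  by rewrite !mulr0 subrr mulr0.
- exact: H.
- by rewrite ncZE ncBE !ncvarM_cons !ncwordE !mulr0 subrr mulr0.
- by rewrite ncZE ncBE !ncvarM_nil subrr mulr0.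
Qed.

Definition rc0 psi : Prop := rc psi /\ comm_coef psi = 0.

End ReducedCoaction.

Section P5.
Variable k : fieldType.

(* The letter (i, j) stands for the generator x_(i+1)(j+1). *)
Definition p5letter : finType := ('I_5 * 'I_5)%type.
Local Notation F := (ncps p5letter k).

Definition strand (i : nat) : 'I_5 := inord i.-1.

(* x_ij, for 1 <= i, j <= 5 *)
Definition p5x (i j : nat) : F := ncvar k ((strand i, strand j) : p5letter).

Definition p5gen (i j : 'I_5) : F := ncvar k ((i, j) : p5letter).

Inductive p5_relator : F -> Prop :=
| P5sym i j : p5_relator (p5gen i j - p5gen j i)
| P5diag i : p5_relator (p5gen i i)
| P5sum i : p5_relator (\sum_j p5gen i j)
| P5comm i j l m : [set i; j] :&: [set l; m] = set0 ->
    p5_relator (ncbr (p5gen i j) (p5gen l m)).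

(* The two-sided ideal generated by the relators, and then its closure. *)
Inductive p5_span : F -> Prop :=
| P5span0 : p5_span 0
| P5spanM a r b : p5_relator r -> p5_span (a * r * b)
| P5spanB f g : p5_span f -> p5_span g -> p5_span (f - g).

Definition p5_ideal : {pred F} := fun f => `[< forall n : nat,
  exists2 g, p5_span g & forall w, (size w <= n)%N -> f w = g w >].

Fact p5_ideal_zmod : zmod_closed p5_ideal.
Proof.
split=> [|f g /asboolP Hf /asboolP Hg]; apply/asboolP => n.
  by exists 0; first exact: P5span0.
have [f' Sf Ef] := Hf n; have [g' Sg Eg] := Hg n.
exists (f' - g') => [|w wn]; first exact: P5spanB.
by rewrite !ncBE Ef ?Eg.
Qed.
HB.instance Definition _ := GRing.isZmodClosed.Build F p5_ideal p5_ideal_zmod.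

(* The completed enveloping algebra of p_5, which contains p_5: all the
   relators are Lie elements. *)
Definition Up5 : zmodType := Quotient.quot p5_ideal.

(* psi_ijk = psi(x_ij, x_jk) *)
Definition psi_ijk (psi : ncps bool k) (i j l : nat) : Up5 :=
  \pi_(Quotient.quot p5_ideal) (ev2 psi (p5x i j) (p5x j l)).

(* Coordinates of x_ij in the basis x_45, x_34, x_24, x_12, x_23. *)
Definition p5_coord (i j : nat) : seq int :=
  match minn i j, maxn i j with
  | 1, 2 => [:: 0; 0; 0; 1; 0]
  | 1, 3 => [:: 1; 0; 0; -1; -1]
  | 1, 4 => [:: -1; -1; -1; 0; 0]
  | 1, 5 => [:: 0; 1; 1; 0; 1]
  | 2, 3 => [:: 0; 0; 0; 0; 1]
  | 2, 4 => [:: 0; 0; 1; 0; 0]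
  | 2, 5 => [:: 0; 0; -1; -1; -1]
  | 3, 4 => [:: 0; 1; 0; 0; 0]
  | 3, 5 => [:: -1; -1; 0; 1; 0]
  | 4, 5 => [:: 1; 0; 0; 0; 0]
  | _, _ => [:: 0; 0; 0; 0; 0]
  end.

(* Linear forms on the span of the letters. *)
Definition form := p5letter -> k.

Definition omega (r : nat) : form :=
  fun g => (nth 0 (p5_coord g.1.+1 g.2.+1) r)%:~R.

Definition w45 : form := omega 0.
Definition w34 : form := omega 1.
Definition w24 : form := omega 2.
Definition w12 : form := omega 3.
Definition w23 : form := omega 4.

Definition addform (u v : form) : form := fun g => u g + v g.
Definition subform (u v : form) : form := fun g => u g - v g.

(* A form vanishing on the degree-one relators, that is, a linear form on the
   degree-one part of p_5. *)
Definition p5_form (u : form) : Prop :=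
  [/\ forall i j, u (i, j) = u (j, i), forall i, u (i, i) = 0
    & forall i, \sum_j u (i, j) = 0].

Definition letter (i j : nat) : p5letter := (strand i, strand j).

Lemma omega_form r : p5_form (omega r).
Proof.
split=> [i j|i|i].
- by rewrite /omega /p5_coord minnC maxnC.
- by case: i => [[|[|[|[|[|?]]]]] ?] //; rewrite /omega /=;
     case: r => [|[|[|[|[|[|r]]]]]].
rewrite !big_ord_recl big_ord0 addr0 /omega -!intrD.
by case: i => [[|[|[|[|[|?]]]]] ?] //; case: r => [|[|[|[|[|[|r]]]]]].
Qed.

(* The forms are the basis dual to x_45, x_34, x_24, x_12, x_23. *)
Lemma omega_dual : [pchar k] =i pred0 -> forall u : form, p5_form u ->
  forall g, u g = u (letter 4 5) * w45 g + u (letter 3 4) * w34 g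
    + u (letter 2 4) * w24 g + u (letter 1 2) * w12 g + u (letter 2 3) * w23 g.
Proof.
move=> ch0 u [us ud uS].
have two0 : 2%:R != 0 :> k by move/pcharf0P: ch0 => ->.
pose o (n : nat) (h : (n < 5)%N) : 'I_5 := Ordinal h.
pose i1 := @o 0 isT; pose i2 := @o 1 isT; pose i3 := @o 2 isT.
pose i4 := @o 3 isT; pose i5 := @o 4 isT.
have S i : u (i, i1) + u (i, i2) + u (i, i3) + u (i, i4) + u (i, i5) = 0.
  rewrite -(uS i) !big_ord_recl big_ord0 addr0 -!addrA.
  by do !congr (_ + _); congr (u (_, _)); apply: val_inj.
have st n (h : (n.-1 < 5)%N) : strand n = Ordinal h.
  by apply: val_inj; rewrite /strand /= inordK.
rewrite /letter (st 1 isT) (st 2 isT) (st 3 isT) (st 4 isT) (st 5 isT).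
rewrite -/(o 0 isT) -/(o 1 isT) -/(o 2 isT) -/(o 3 isT) -/(o 4 isT).
rewrite -/i1 -/i2 -/i3 -/i4 -/i5.
have := S i1; have := S i2; have := S i3; have := S i4; have := S i5.
rewrite !ud (us i2 i1) (us i3 i1) (us i4 i1) (us i5 i1) (us i3 i2) (us i4 i2).
rewrite (us i5 i2) (us i4 i3) (us i5 i3) (us i5 i4) => e5 e4 e3 e2 e1.
have E15 : u (i1, i5) = u (i2, i4) + u (i3, i4) + u (i2, i3).
  apply: (mulfI two0); apply/eqP; rewrite -subr_eq0; apply/eqP.
  transitivity ((u (i1, i2) + u (i1, i3) + u (i1, i4) + u (i1, i5)) + (u (i1, i5) + u (i2, i5) + u (i3, i5) + u (i4, i5))
    - ((u (i1, i2) + u (i2, i3) + u (i2, i4) + u (i2, i5))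
    + (u (i1, i3) + u (i2, i3) + u (i3, i4) + u (i3, i5))
    + (u (i1, i4) + u (i2, i4) + u (i3, i4) + u (i4, i5)))); first by ring.
  move: e1 e2 e3 e4 e5; rewrite !(addr0, add0r) => -> -> -> -> ->.
  by rewrite !addr0 subrr.
have E25 : u (i2, i5) = - (u (i1, i2) + u (i2, i3) + u (i2, i4)).
  by apply/eqP; rewrite -subr_eq0; apply/eqP; rewrite -e2; ring.
have E14 : u (i1, i4) = - (u (i2, i4) + u (i3, i4) + u (i4, i5)).
  by apply/eqP; rewrite -subr_eq0; apply/eqP; rewrite -e4; ring.
have E35 : u (i3, i5) = u (i1, i2) - u (i3, i4) - u (i4, i5).
  apply/eqP; rewrite -subr_eq0; apply/eqP; rewrite -e5 E15 E25; ring.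
have E13 : u (i1, i3) = u (i4, i5) - u (i1, i2) - u (i2, i3).
  apply/eqP; rewrite -subr_eq0; apply/eqP; rewrite -e3 E35; ring.
have R : {in [:: i1; i2; i3; i4; i5] &, forall i j, u (i, j) =
    u (i4, i5) * w45 (i, j) + u (i3, i4) * w34 (i, j) +
    u (i2, i4) * w24 (i, j) + u (i1, i2) * w12 (i, j) +
    u (i2, i3) * w23 (i, j)}; last first.
  by case=> i j; apply: R; case: i j => [[|[|[|[|[|?]]]]] ?] // [[|[|[|[|[|?]]]]] ?].
move=> i j; rewrite !inE => /or4P[/eqP->|/eqP->|/eqP->|/orP[]/eqP->]
  /or4P[/eqP->|/eqP->|/eqP->|/orP[]/eqP->];
  rewrite /w45 /w34 /w24 /w12 /w23 /omega /=;
  rewrite ?ud ?(us i2 i1) ?(us i3 i1) ?(us i4 i1) ?(us i5 i1) ?(us i3 i2)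
    ?(us i4 i2) ?(us i5 i2) ?(us i4 i3) ?(us i5 i3) ?(us i5 i4)
    ?E15 ?E25 ?E14 ?E35 ?E13; ring.
Qed.

Lemma omega_basis :
  [seq [seq w g | w : form <- [:: w45; w34; w24; w12; w23]]
     | g <- [:: letter 4 5; letter 3 4; letter 2 4; letter 1 2; letter 2 3]]
  = [:: [:: 1; 0; 0; 0; 0]; [:: 0; 1; 0; 0; 0]; [:: 0; 0; 1; 0; 0];
        [:: 0; 0; 0; 1; 0]; [:: 0; 0; 0; 0; 1]].
Proof.
by rewrite /= /w45 /w34 /w24 /w12 /w23 /omega /letter /strand /= !inordK.
Qed.

(* Functionals on series in the letters. Because the forms are defined on all the
   letters (i, j), and not only on the five basis ones, a word of forms first
   rewrites every letter in the basis, and then extracts a coefficient. *)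
Definition p5fun := F -> k.

(* [ ] *)
Definition bar0 : p5fun := fun f => f [::].

(* [u|l] *)
Definition barcons (u : form) (l : p5fun) : p5fun :=
  fun f => l (NCps (fun v => \sum_g u g * f (g :: v))).

(* [u_1|..|u_n] *)
Definition barword (us : seq form) : p5fun := foldr barcons bar0 us.

End P5.

Arguments p5_ideal k : clear implicits.

(* Two consecutive steps of the recursion of bar, abstractly. *)
Section Commute.
Variables (k : fieldType) (M I : Type) (act : I -> M -> M).
Variables (V : seq nat -> seq nat -> M -> k) (o45 o34 o24 o12 o23 : I -> k).

Hypothesis V_l0S : forall b q g f, all (leq 1) b ->
  V [::] (rcons b q.+2) (act g f) = o45 g * V [::] (rcons b q.+1) f.
Hypothesis V_l01 : forall b g f,
  V [::] (rcons b 1) (act g f) = - (o34 g * V [::] b f).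
Hypothesis V_nil : forall g f, V [::] [::] (act g f) = 0.
Hypothesis V_r0S : forall a p g f,
  V (rcons a p.+2) [::] (act g f) = (o12 g + o45 g) * V (rcons a p.+1) [::] f.
Hypothesis V_r01 : forall a g f,
  V (rcons a 1) [::] (act g f) = - (o24 g * V a [::] f).
Hypothesis V_peelSS : forall a p b q g f, all (leq 1) a -> all (leq 1) b ->
  V (rcons a p.+2) (rcons b q.+2) (act g f) =
  o12 g * V (rcons a p.+1) (rcons b q.+2) f
  + o45 g * V (rcons a p.+2) (rcons b q.+1) f.
Hypothesis V_peelS1 : forall a p b g f, all (leq 1) a -> all (leq 1) b ->
  V (rcons a p.+2) (rcons b 1) (act g f) =
  o12 g * V (rcons a p.+1) (rcons b 1) f - o34 g * V (rcons a p.+2) b f.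
Hypothesis V_peel1S : forall a b q g f, all (leq 1) a -> all (leq 1) b ->
  V (rcons a 1) (rcons b q.+2) (act g f) =
  - (o23 g * V a (rcons b q.+2) f)
  - (o12 g - o23 g) * V (rcons a (head 0%N (rcons b q.+2)))
                        (behead (rcons b q.+2)) f
  + o45 g * V (rcons a 1) (rcons b q.+1) f.
Hypothesis V_peel11 : forall a b g f, all (leq 1) a -> all (leq 1) b ->
  V (rcons a 1) (rcons b 1) (act g f) =
  - (o23 g * V a (rcons b 1) f)
  - (o12 g - o23 g) * V (rcons a (head 0%N (rcons b 1)))
                        (behead (rcons b 1)) f
  - o34 g * V (rcons a 1) b f.

Variables g h : I.
Hypothesis W1 : o12 g * o23 h = o12 h * o23 g.
Hypothesis W2 : o45 g * o34 h = o45 h * o34 g.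
Hypothesis W3 : o45 g * o24 h = o45 h * o24 g + o12 h * o24 g - o12 g * o24 h.
Hypothesis W4 : o23 g * o34 h = o23 h * o34 g
   - (o12 g - o23 g + o34 g) * o24 h + (o12 h - o23 h + o34 h) * o24 g.

Let hd0 m : (head 0 (rcons [::] m))%N = m. Proof. by []. Qed.
Let hd1 c m : (head 0 (rcons (rcons [::] c) m))%N = c. Proof. by []. Qed.
Let hd2 c b m : (head 0 (rcons (c :: b) m))%N = c. Proof. by []. Qed.
Let hd3 c b r m : (head 0 (rcons (rcons (c :: b) r) m))%N = c. Proof. by []. Qed.
Let bh0 (m : nat) : behead (rcons [::] m) = [::]. Proof. by []. Qed.
Let bh1 (c m : nat) : behead (rcons (rcons [::] c) m) = rcons [::] m.
Proof. by []. Qed.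
Let bh2 (c m : nat) b : behead (rcons (c :: b) m) = rcons b m.
Proof. by []. Qed.
Let bh3 (c r m : nat) b :
  behead (rcons (rcons (c :: b) r) m) = rcons (rcons b r) m.
Proof. by []. Qed.
Let hdE := (hd0, hd1, hd2, hd3, bh0, bh1, bh2, bh3).

Ltac pos := rewrite ?all_rcons /= ?all_rcons /=;
  repeat (apply/andP; split); done.
Ltac peel := repeat (first
  [ rewrite V_nil | rewrite V_l01 | rewrite V_r01 | rewrite V_r0S
  | rewrite V_l0S; [|pos] | rewrite V_peelSS; [|pos|pos]
  | rewrite V_peelS1; [|pos|pos] | rewrite V_peel1S; [|pos|pos]
  | rewrite V_peel11; [|pos|pos] | rewrite hdE]).
Ltac fin := peel; first [ring | ring: W1 | ring: W2 | ring: W3 | ring: W4 | ring: W1 W2 | ring: W1 W3 | ring: W2 W3 | ring: W3 W4 | ring: W1 W4 | ring: W2 W4 | ring: W1 W2 W4 | ring: W1 W3 W4 | ring: W2 W3 W4 | ring: W4 W3 W2 W1].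

Lemma commute a b f : all (leq 1) a -> all (leq 1) b ->
  V a b (act g (act h f)) = V a b (act h (act g f)).
Proof.
case/lastP: a => [|a n]; case/lastP: b => [|b m]; rewrite ?all_rcons.
- by move=> _ _; rewrite !V_nil.
- move=> _ /andP[]; case: m => [//|[|[|m]]] _ b0; last 2 first.
  + fin.
  + fin.
  case/lastP: b b0 => [|b r]; rewrite ?all_rcons; first by move=> _; fin.
  by case: r => [//|[|r]] b0; fin.
- move=> /andP[]; case: n => [//|[|[|n]]] _ a0 _; last 2 first.
  + fin.
  + fin.
  case/lastP: a a0 => [|a r]; rewrite ?all_rcons; first by move=> _; fin.
  by case: r => [//|[|r]] a0; fin.
move=> /andP[]; case: n => [//|[|[|n]]] _ a0 /andP[];
  case: m => [//|[|[|m]]] _ b0; last 6 first.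
- case/lastP: b b0 => [|b r]; rewrite ?all_rcons; first by move=> _; fin.
  by case: r => [//|[|r]] /andP[_ b0]; fin.
- fin.
- fin.
- case/lastP: b b0 => [|b r]; rewrite ?all_rcons; first by move=> _; fin.
  by case: r => [//|[|r]] /andP[_ b0]; fin.
- fin.
- fin.
all: case/lastP: a a0 => [|a s]; rewrite ?all_rcons;
  [move=> _ | case: s => [//|[|s]] /andP[_ a0]].
all: case/lastP: b b0 => [|b r]; rewrite ?all_rcons;
  [move=> _; fin | case: r => [//|[|r]] /andP[_ b0]].
all: case: b b0 => [|c b]; [move=> _; fin | move=> /andP[]].
all: case: c => [//|[|c]] _ b0; fin.
Qed.

End Commute.

(* (a_1, .., a_k), k >= 1, with positive entries *)
Definition is_index (a : seq nat) : bool := (a != [::]) && all (leq 1) a.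

Definition front (a : seq nat) : seq nat := take (size a).-1 a.
Definition decr (a : seq nat) : seq nat := rcons (front a) (last 0 a).-1.

Lemma front_rcons a n : front (rcons a n) = a.
Proof. by rewrite /front size_rcons -cats1 take_size_cat. Qed.

Lemma decr_rcons a n : decr (rcons a n) = rcons a n.-1.
Proof. by rewrite /decr front_rcons last_rcons. Qed.

Section Bar.
Variable k : fieldType.
Local Notation F := (ncps p5letter k).
Local Notation form := (form k).
Local Notation p5fun := (p5fun k).

(* (-1)^k [u^(a_k - 1)|v|..|u^(a_1 - 1)|v] *)
Definition bar1 (u v : form) (a : seq nat) : p5fun := fun f =>
  (-1) ^+ size a
    * barword (flatten [seq rcons (nseq n.-1 u) v | n <- rev a]) f.

Section Forms.
Variables o45 o34 o24 o12 o23 : form.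

(* The first argument bounds the recursion: each step lowers the total weight
   of the two indices by one (see barE). *)
Fixpoint bar_rec (n : nat) (a b : seq nat) : p5fun :=
  if a is [::] then bar1 o45 o34 b else
  if b is [::] then bar1 (addform o12 o45) o24 a else
  if n is n'.+1 then
    let X : p5fun :=
      if last 0%N a != 1%N then barcons o12 (bar_rec n' (decr a) b)
      else fun f =>
        - barcons o23 (bar_rec n' (front a) b) f
        - barcons (subform o12 o23)
            (bar_rec n' (rcons (front a) (head 0%N b)) (behead b)) f in
    let Y : p5fun :=
      if last 0%N b != 1%N then barcons o45 (bar_rec n' a (decr b))
      else fun f => - barcons o34 (bar_rec n' a (front b)) f in
    fun f => X f + Y f
  else fun=> 0.

Definition bar (a b : seq nat) : p5fun := bar_rec (sumn a + sumn b) a b.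

Lemma sumn_front a : last 0%N a = 1%N -> sumn a = (sumn (front a)).+1.
Proof.
case/lastP: a => // a n; rewrite last_rcons => ->.
by rewrite front_rcons sumn_rcons addn1.
Qed.

Lemma sumn_decr a : is_index a -> sumn a = (sumn (decr a)).+1.
Proof.
case/lastP: a => // a n /andP[_]; rewrite all_rcons => /andP[n0 _].
by rewrite decr_rcons !sumn_rcons -addnS prednK.
Qed.

Lemma index_decr a : is_index a -> last 0%N a != 1%N -> is_index (decr a).
Proof.
case/lastP: a => // a n /andP[_]; rewrite all_rcons => /andP[n0 a0].
rewrite last_rcons decr_rcons /is_index all_rcons a0 andbT => n1.
by rewrite -size_eq0 size_rcons /=; lia.
Qed.

Lemma all_front a : all (leq 1) a -> all (leq 1) (front a).
Proof. by move=> /allP H; apply/allP => x /mem_take/H. Qed.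

Lemma bar_rec_fuel n a b : all (leq 1) a -> all (leq 1) b ->
  (sumn a + sumn b <= n)%N -> bar_rec n a b = bar a b.
Proof.
rewrite /bar; move E : (sumn a + sumn b)%N => m.
elim: m n a b E => [|m IH] n a b.
  case: a => [|p a]; first by case: n.
  case: b => [|q b]; first by case: n.
  by move=> /= E /andP[p0 _]; lia.
case: n => [|n]; first by lia.
case: a => [|p a] //; case: b => [|q b] //.
set a1 := p :: a; set b1 := q :: b => E a0 b0 /ltnSE mn.
have ia : is_index a1 by rewrite /is_index a0.
have ib : is_index b1 by rewrite /is_index b0.
rewrite /= -/a1 -/b1; apply/funext => f; congr (_ + _).
- case: ifPn => a1k.
    have /andP[_ ?] := index_decr ia a1k.
    have e := sumn_decr ia.
    by rewrite IH // ; lia.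
  have e := @sumn_front a1 (eqP (negbNE a1k)); have f0 := all_front a0.
  have : all (leq 1) (rcons (front a1) q) /\ all (leq 1) b.
    by move: b0 => /= /andP[q0 b0]; rewrite all_rcons q0.
  case=> ? ?; rewrite !IH ?sumn_rcons //; move: E; rewrite e /b1 /=; lia.
- case: ifPn => b1k.
    have /andP[_ ?] := index_decr ib b1k.
    have e := sumn_decr ib.
    by rewrite IH // ; lia.
  have e := @sumn_front b1 (eqP (negbNE b1k)); have f0 := all_front b0.
  by rewrite IH //; move: E; lia.
Qed.

Lemma bar0l b : bar [::] b = bar1 o45 o34 b.
Proof. by rewrite /bar; case: (_ + _)%N. Qed.

Lemma bar0r a : a != [::] -> bar a [::] = bar1 (addform o12 o45) o24 a.
Proof. by case: a => // p a _; rewrite /bar; case: (_ + _)%N. Qed.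

Lemma barE a b : is_index a -> is_index b -> bar a b = fun f =>
  (if last 0%N a != 1%N then barcons o12 (bar (decr a) b) f
   else - barcons o23 (bar (front a) b) f
        - barcons (subform o12 o23)
            (bar (rcons (front a) (head 0%N b)) (behead b)) f)
  + (if last 0%N b != 1%N then barcons o45 (bar a (decr b)) f
     else - barcons o34 (bar a (front b)) f).
Proof.
move=> ia ib; have [/andP[a0 ap] /andP[b0 bp]] := (ia, ib).
have ea := sumn_decr ia; have eb := sumn_decr ib.
rewrite {1}/bar ea addSn; move En : (_ + _)%N => n.
have -> : bar_rec n.+1 a b = fun f =>
  (if last 0%N a != 1%N then barcons o12 (bar_rec n (decr a) b) f
   else - barcons o23 (bar_rec n (front a) b) f
        - barcons (subform o12 o23)
            (bar_rec n (rcons (front a) (head 0%N b)) (behead b)) f)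
  + (if last 0%N b != 1%N then barcons o45 (bar_rec n a (decr b)) f
     else - barcons o34 (bar_rec n a (front b)) f).
  case: a {ia ap ea En} a0 => // p a _; case: b {ib bp eb} b0 => // q b _.
  by apply/funext => f /=; congr (_ + _); case: ifP.
have ab : all (leq 1) (rcons (front a) (head 0%N b)) /\ all (leq 1) (behead b).
  case: (b) b0 bp => //= q b' _ /andP[q0 b'0].
  by rewrite all_rcons q0 all_front.
apply/funext => f; congr (_ + _); case: ifPn => [h|/negPn/eqP h].
- have /andP[_ ?] := index_decr ia h.
  by rewrite bar_rec_fuel //; lia.
- have e := sumn_front h; rewrite !bar_rec_fuel ?all_front ?ab.1 ?ab.2 //.
    by rewrite sumn_rcons; case: (b) b0 En => //= q b' _; lia.
  by lia.
- have /andP[_ ?] := index_decr ib h.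
  by rewrite bar_rec_fuel //; lia.
- have e := sumn_front h; rewrite bar_rec_fuel ?all_front //; lia.
Qed.

End Forms.

Section Descent.

Definition bounded_linear (l : p5fun) : Prop :=
  (forall c f g, l (c *: f + g) = c * l f + l g) /\
  exists n, forall f g : F,
    (forall w, (size w <= n)%N -> f w = g w) -> l f = l g.

Lemma blin_bar0 : bounded_linear (@bar0 k).
Proof. by split=> //; exists 0%N => f g; apply. Qed.

Lemma blin_cons u l : bounded_linear l -> bounded_linear (barcons u l).
Proof.
move=> [lin [n loc]]; split=> [c f g|].
  rewrite -lin; congr l; apply/ncpsP => w; rewrite ncDE ncZE /=.
  rewrite mulr_sumr -big_split; apply: eq_bigr => h _ /=.
  by rewrite mulrDr mulrCA.
exists n.+1 => f g fg; apply: loc => w wn /=.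
by apply: eq_bigr => h _; rewrite fg.
Qed.

Lemma blin_comb c l d m : bounded_linear l -> bounded_linear m ->
  bounded_linear (fun f => c * l f + d * m f).
Proof.
move=> [lin [n loc]] [lin' [n' loc']]; split=> [e f g|].
  by rewrite lin lin'; ring.
exists (maxn n n') => f g fg; congr (_ * _ + _ * _).
- by apply: loc => w wn; apply: fg; rewrite leq_max wn.
- by apply: loc' => w wn; apply: fg; rewrite leq_max wn orbT.
Qed.

Lemma blin_ext l m : (forall f, l f = m f) -> bounded_linear m ->
  bounded_linear l.
Proof. by move=> /funext->. Qed.

Lemma blin_scale c l : bounded_linear l -> bounded_linear (fun f => c * l f).
Proof.
move=> bl; apply: blin_ext (blin_comb c 0 bl bl) => f.
by rewrite mul0r addr0.
Qed.

Lemma blin_opp l : bounded_linear l -> bounded_linear (fun f => - l f).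
Proof. by move/(blin_scale (-1)); apply: blin_ext => f; rewrite mulN1r. Qed.

Lemma blin_add l m : bounded_linear l -> bounded_linear m ->
  bounded_linear (fun f => l f + m f).
Proof.
move=> bl bm; apply: blin_ext (blin_comb 1 1 bl bm) => f.
by rewrite !mul1r.
Qed.

Lemma blin0 l : bounded_linear l -> l 0 = 0.
Proof.
by case=> lin _; have := lin (-1) 0 0; rewrite scaler0 addr0 mulN1r addNr.
Qed.

Lemma blinZ l c f : bounded_linear l -> l (c *: f) = c * l f.
Proof. by move=> bl; rewrite -[_ *: _]addr0 bl.1 (blin0 bl) addr0. Qed.

Lemma blinD l f g : bounded_linear l -> l (f + g) = l f + l g.
Proof. by case=> lin _; have := lin 1 f g; rewrite scale1r mul1r. Qed.

Lemma blinB l f g : bounded_linear l -> l (f - g) = l f - l g.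
Proof. by move=> bl; rewrite (blinD _ _ bl) -scaleN1r (blinZ _ _ bl) mulN1r. Qed.

Lemma blin_sum l (I : Type) (r : seq I) (f : I -> F) : bounded_linear l ->
  l (\sum_(i <- r) f i) = \sum_(i <- r) l (f i).
Proof.
move=> bl; elim: r => [|i r IH]; first by rewrite !big_nil (blin0 bl).
by rewrite !big_cons (blinD _ _ bl) IH.
Qed.

Lemma barcons_var u l g f : bounded_linear l ->
  barcons u l (ncvar k g * f) = u g * l f.
Proof.
move=> bl; rewrite -(blinZ _ _ bl); congr l; apply/ncpsP => w.
transitivity (\sum_h u h * (ncvar k g * f) (h :: w)) => //.
rewrite ncZE (bigD1 g isT) ncvarM_cons eqxx mul1r.
rewrite big1 ?Monoid.mulm1 // => h hg.
by rewrite ncvarM_cons (negbTE hg) mul0r mulr0.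
Qed.

Lemma nc_decomp (f : F) :
  f = f [::] *: 1 + \sum_g ncvar k g * ncder g f.
Proof.
have sumE (f' : p5letter -> F) w : (\sum_g f' g) w = \sum_g f' g w.
  by elim/big_rec2: _ => // g _ s _ <-.
apply/ncpsP => -[|g w]; rewrite ncDE ncZE nc1E sumE.
  by rewrite mulr1 big1 ?addr0 // => h _; rewrite ncvarM_nil.
rewrite mulr0 add0r (bigD1 g isT) ncvarM_cons eqxx mul1r.
rewrite big1 ?Monoid.mulm1 // => h hg.
by rewrite ncvarM_cons eq_sym (negbTE hg) mul0r.
Qed.

Lemma bar1_nil u v : bar1 u v [::] = @bar0 k.
Proof. by apply/funext => f; rewrite /bar1 mul1r. Qed.

Lemma bar1_rconsS u v a n :
  bar1 u v (rcons a n.+2) = barcons u (bar1 u v (rcons a n.+1)).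
Proof. by apply/funext => f; rewrite /bar1 !rev_rcons !size_rcons. Qed.

Lemma bar1_rcons1 u v a f :
  bar1 u v (rcons a 1) f = - barcons v (bar1 u v a) f.
Proof. by rewrite /bar1 !rev_rcons !size_rcons exprS mulN1r mulNr. Qed.

Lemma blin_word us : bounded_linear (barword (k := k) us).
Proof. by elim: us => [|u us]; [exact: blin_bar0 | exact: blin_cons]. Qed.

Lemma blin_bar1 u v a : bounded_linear (bar1 u v a).
Proof. exact/blin_scale/blin_word. Qed.

Section Forms.
Variables o45 o34 o24 o12 o23 : form.
Local Notation V := (bar o45 o34 o24 o12 o23).

Lemma blin_bar a b : all (leq 1) a -> all (leq 1) b -> bounded_linear (V a b).
Proof.
rewrite /bar; move: (sumn a + sumn b)%N => n.
elim: n a b => [|n IH] a b a0 b0.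
  case: a a0 => [|p a] a0; first exact: blin_bar1.
  case: b b0 => [|q b] b0; first exact: blin_bar1.
  split; first by move=> c f g /=; rewrite mulr0 addr0.
  by exists 0%N.
case: a a0 => [|p a] a0; first exact: blin_bar1.
case: b b0 => [|q b] b0; first exact: blin_bar1.
have D c (s : seq nat) : last 0%N (c :: s) != 1%N -> all (leq 1) (c :: s) ->
    all (leq 1) (decr (c :: s)).
  by move=> h h0; have /andP[] := @index_decr (c :: s) h0 h.
have R := all_front a0.
have [q0 b'0] := andP b0.
apply: blin_add.
- case: ifPn => [h|_]; first exact/blin_cons/IH/b0/D.
  apply: blin_add; apply: blin_opp; apply/blin_cons/IH => //.
  by rewrite all_rcons q0.
- case: ifPn => [h|_]; first exact/blin_cons/IH/D.
  by apply/blin_opp/blin_cons/IH; rewrite ?all_front.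
Qed.

Lemma V_l0S b q g f : all (leq 1) b ->
  V [::] (rcons b q.+2) (ncvar k g * f) = o45 g * V [::] (rcons b q.+1) f.
Proof. by move=> _; rewrite !bar0l bar1_rconsS (barcons_var _ _ _ (blin_bar1 _ _ _)). Qed.

Lemma V_l01 b g f : V [::] (rcons b 1) (ncvar k g * f) = - (o34 g * V [::] b f).
Proof. by rewrite !bar0l bar1_rcons1 (barcons_var _ _ _ (blin_bar1 _ _ _)). Qed.

Lemma V_nil g f : V [::] [::] (ncvar k g * f) = 0.
Proof. by rewrite bar0l bar1_nil /bar0 ncvarM_nil. Qed.

Lemma V_r0S a p g f :
  V (rcons a p.+2) [::] (ncvar k g * f)
  = (o12 g + o45 g) * V (rcons a p.+1) [::] f.
Proof.
by rewrite !bar0r -?size_eq0 ?size_rcons // bar1_rconsS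
  (barcons_var _ _ _ (blin_bar1 _ _ _)).
Qed.

Lemma V_r01 a g f :
  V (rcons a 1) [::] (ncvar k g * f) = - (o24 g * V a [::] f).
Proof.
rewrite bar0r -?size_eq0 ?size_rcons // bar1_rcons1.
rewrite (barcons_var _ _ _ (blin_bar1 _ _ _)).
by case: a => [|p a]; rewrite ?bar0l ?bar1_nil // bar0r.
Qed.

Lemma index_rconsS a p : all (leq 1) a -> is_index (rcons a p.+1).
Proof. by move=> a0; rewrite /is_index all_rcons a0 -size_eq0 size_rcons. Qed.

Lemma V_peel a p b q g f : all (leq 1) a -> all (leq 1) b ->
  V (rcons a p.+1) (rcons b q.+1) (ncvar k g * f) =
  (if p is p'.+1 then o12 g * V (rcons a p'.+1) (rcons b q.+1) f
   else - (o23 g * V a (rcons b q.+1) f)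
        - (o12 g - o23 g) * V (rcons a (head 0%N (rcons b q.+1)))
                              (behead (rcons b q.+1)) f)
  + (if q is q'.+1 then o45 g * V (rcons a p.+1) (rcons b q'.+1) f
     else - (o34 g * V (rcons a p.+1) b f)).
Proof.
move=> a0 b0; have iA p' := index_rconsS p' a0; have iB q' := index_rconsS q' b0.
have A p' : all (leq 1) (rcons a p'.+1) by rewrite all_rcons a0.
have B q' : all (leq 1) (rcons b q'.+1) by rewrite all_rcons b0.
rewrite barE // !last_rcons !front_rcons !decr_rcons.
have : all (leq 1) (rcons a (head 0%N (rcons b q.+1))) /\
       all (leq 1) (behead (rcons b q.+1)).
  have := B q; case E : (rcons b q.+1) => [|c s]; first by case: (b) E.
  by move=> /= /andP[c0 ->]; rewrite all_rcons c0.
move=> [C D]; case: p => [|p]; case: q C D => [|q] C D;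
  by rewrite /= !(barcons_var _ _ _ (blin_bar _ _)).
Qed.

Lemma V_peelSS a p b q g f : all (leq 1) a -> all (leq 1) b ->
  V (rcons a p.+2) (rcons b q.+2) (ncvar k g * f) =
  o12 g * V (rcons a p.+1) (rcons b q.+2) f
  + o45 g * V (rcons a p.+2) (rcons b q.+1) f.
Proof. by move=> a0 b0; rewrite V_peel. Qed.

Lemma V_peelS1 a p b g f : all (leq 1) a -> all (leq 1) b ->
  V (rcons a p.+2) (rcons b 1) (ncvar k g * f) =
  o12 g * V (rcons a p.+1) (rcons b 1) f - o34 g * V (rcons a p.+2) b f.
Proof. by move=> a0 b0; rewrite V_peel. Qed.

Lemma V_peel1S a b q g f : all (leq 1) a -> all (leq 1) b ->
  V (rcons a 1) (rcons b q.+2) (ncvar k g * f) =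
  - (o23 g * V a (rcons b q.+2) f)
  - (o12 g - o23 g) * V (rcons a (head 0%N (rcons b q.+2)))
                        (behead (rcons b q.+2)) f
  + o45 g * V (rcons a 1) (rcons b q.+1) f.
Proof. by move=> a0 b0; rewrite V_peel. Qed.

Lemma V_peel11 a b g f : all (leq 1) a -> all (leq 1) b ->
  V (rcons a 1) (rcons b 1) (ncvar k g * f) =
  - (o23 g * V a (rcons b 1) f)
  - (o12 g - o23 g) * V (rcons a (head 0%N (rcons b 1)))
                        (behead (rcons b 1)) f
  - o34 g * V (rcons a 1) b f.
Proof. by move=> a0 b0; rewrite V_peel. Qed.

Lemma V_comm g h a b f :
    o12 g * o23 h = o12 h * o23 g ->
    o45 g * o34 h = o45 h * o34 g ->
    o45 g * o24 h = o45 h * o24 g + o12 h * o24 g - o12 g * o24 h ->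
    o23 g * o34 h = o23 h * o34 g
      - (o12 g - o23 g + o34 g) * o24 h + (o12 h - o23 h + o34 h) * o24 g ->
  all (leq 1) a -> all (leq 1) b ->
  V a b (ncvar k g * (ncvar k h * f)) = V a b (ncvar k h * (ncvar k g * f)).
Proof.
move=> W1 W2 W3 W4 a0 b0.
have H := @commute k F p5letter (fun g f => ncvar k g * f) V o45 o34 o24 o12 o23
  V_l0S V_l01 V_nil V_r0S V_r01 V_peelSS V_peelS1 V_peel1S V_peel11 g h
  W1 W2 W3 W4 a b f a0 b0.
exact: H.
Qed.

Lemma V_step n a b : all (leq 1) a -> all (leq 1) b ->
    (sumn a + sumn b)%N = n.+1 ->
  exists l1 l2 l3 l4 l5 : p5fun,
    (forall g f, V a b (ncvar k g * f) = o12 g * l1 f + o23 g * l2 f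
       + o45 g * l3 f + o34 g * l4 f + o24 g * l5 f) /\
    forall f, (forall a' b', all (leq 1) a' -> all (leq 1) b' ->
        (sumn a' + sumn b')%N = n -> V a' b' f = 0) ->
      [/\ l1 f = 0, l2 f = 0, l3 f = 0, l4 f = 0 & l5 f = 0].
Proof.
pose z : p5fun := fun=> 0.
case/lastP: a => [|a p]; case/lastP: b => [|b q] //;
  rewrite ?all_rcons ?sumn_rcons.
- move=> _ /andP[]; case: q => [//|[|q]] _ b0 E.
    exists z, z, z, (fun f => - V [::] b f), z; split=> [g f|f H].
      by rewrite V_l01 /z; ring.
    by split=> //; rewrite H ?oppr0 //; lia.
  exists z, z, (V [::] (rcons b q.+1)), z, z; split=> [g f|f H].
    by rewrite V_l0S // /z; ring.
  by split=> //; apply: H; rewrite ?all_rcons ?sumn_rcons //=; move: E => /=; lia.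
- move=> /andP[]; case: p => [//|[|p]] _ a0 _ E.
    exists z, z, z, z, (fun f => - V a [::] f); split=> [g f|f H].
      by rewrite V_r01 /z; ring.
    by split=> //; rewrite H ?oppr0 //; move: E => /=; lia.
  exists (V (rcons a p.+1) [::]), z, (V (rcons a p.+1) [::]), z, z.
  split=> [g f|f H]; first by rewrite V_r0S /z; ring.
  by split=> //; apply: H; rewrite ?all_rcons ?sumn_rcons //=; move: E => /=; lia.
move=> /andP[p0 a0] /andP[q0 b0]; case: p p0 => // p _; case: q q0 => // q _ E.
pose s := rcons b q.+1; pose J := V (rcons a (head 0%N s)) (behead s).
have sJ : (sumn (rcons a (head 0%N s)) + sumn (behead s))%N
    = (sumn a + sumn s)%N.
  by rewrite sumn_rcons; case: (s) => [|c t] /=; lia.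
have [s1 s2] : all (leq 1) (rcons a (head 0%N s)) /\ all (leq 1) (behead s).
  have : all (leq 1) s by rewrite all_rcons b0.
  case Es : s => [|c t]; first by move: (congr1 size Es); rewrite size_rcons.
  by move=> /= /andP[c0 t0]; rewrite all_rcons c0 a0 t0.
exists (if p is p'.+1 then V (rcons a p'.+1) s else fun f => - J f),
  (if p is p'.+1 then z else fun f => J f - V a s f),
  (if q is q'.+1 then V (rcons a p.+1) (rcons b q'.+1) else z),
  (if q is q'.+1 then z else fun f => - V (rcons a p.+1) b f), z.
split=> [g f|f H].
  by rewrite V_peel // -/s -/(J f); case: p {E} => [|p]; case: q @s @J sJ s1 s2 => [|q] s J *;
    rewrite /z; ring.
have HJ : p = 0%N -> J f = 0.
  by move=> p0; apply: H; rewrite // sJ /s sumn_rcons; lia.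
split.
- case: p E HJ H => [|p] E HJ H; first by rewrite HJ ?oppr0.
  by apply: H; rewrite ?all_rcons ?a0 ?b0 // /s !sumn_rcons; lia.
- case: p E HJ H => [|p] E HJ H //; rewrite HJ // H ?subr0 //.
    by rewrite all_rcons b0.
  by rewrite /s sumn_rcons; lia.
- case: q E H {s J sJ s1 s2 HJ} => [|q] E H //.
  by apply: H; rewrite ?all_rcons ?a0 ?b0 // !sumn_rcons; lia.
- case: q E H {s J sJ s1 s2 HJ} => [|q] E H //.
  by rewrite H ?oppr0 ?all_rcons ?a0 // !sumn_rcons; lia.
- by [].
Qed.

Hypotheses (F45 : p5_form o45) (F34 : p5_form o34) (F24 : p5_form o24).
Hypotheses (F12 : p5_form o12) (F23 : p5_form o23).

(* The relations between the 2-forms in the o's on which integrability rests. *)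
Hypothesis arnold : forall i j l m, [set i; j] :&: [set l; m] = set0 ->
  let g := (i, j) in let h := (l, m) in
  [/\ o12 g * o23 h = o12 h * o23 g,
      o45 g * o34 h = o45 h * o34 g,
      o45 g * o24 h = o45 h * o24 g + o12 h * o24 g - o12 g * o24 h
    & o23 g * o34 h = o23 h * o34 g
      - (o12 g - o23 g + o34 g) * o24 h + (o12 h - o23 h + o34 h) * o24 g].

Lemma V_relator a b r f : all (leq 1) a -> all (leq 1) b -> p5_relator r ->
  V a b (r * f) = 0.
Proof.
move=> a0 b0; case E : (sumn a + sumn b)%N => [|n] Hr.
  have [-> ->] : a = [::] /\ b = [::].
    by case: a a0 E => [|[|?] ?] //; case: b b0 => [|[|?] ?].
  rewrite bar0l bar1_nil /bar0 ncM_nil; case: Hr => [i j|i|i|i j l m _].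
  - by rewrite ncBE subrr mul0r.
  - by rewrite mul0r.
  - have sumE (f' : 'I_5 -> F) : (\sum_g f' g) [::] = \sum_g f' g [::].
      by elim/big_rec2: _ => // g _ s _ <-.
    by rewrite sumE big1 ?mul0r.
  - by rewrite ncBE !ncM_nil mul0r subrr mul0r.
have bl := blin_bar a0 b0.
have [l1 [l2 [l3 [l4 [l5 [H _]]]]]] := V_step a0 b0 E.
case: Hr => [i j|i|i|i j l m D].
- rewrite mulrBl (blinB _ _ bl) !H; apply/eqP; rewrite subr_eq0; apply/eqP.
  by case: F45 F34 F24 F12 F23 => -> _ _ [-> _ _] [-> _ _] [-> _ _] [-> _ _].
- rewrite H; case: F45 F34 F24 F12 F23 => _ -> _ [_ -> _] [_ -> _] [_ -> _].
  by case=> _ -> _; rewrite !mul0r !addr0.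
- rewrite mulr_suml (blin_sum _ _ bl) (eq_bigr _ (fun j _ => H _ _)).
  rewrite !big_split -!mulr_suml.
  case: F45 F34 F24 F12 F23 => _ _ -> [_ _ ->] [_ _ ->] [_ _ ->] [_ _ ->].
  by rewrite !mul0r !Monoid.mulm1.
- rewrite /ncbr mulrBl -!mulrA (blinB _ _ bl).
  by have [? ? ? ?] := arnold D; rewrite V_comm ?subrr.
Qed.

Lemma V_ideal a b u r v : all (leq 1) a -> all (leq 1) b -> p5_relator r ->
  V a b (u * r * v) = 0.
Proof.
move: u; move En : (sumn a + sumn b)%N => n.
elim: n a b En => [|n IH] a b E u a0 b0 Hr;
  rewrite [u]nc_decomp -mulrA mulrDl -scalerAl mul1r mulr_suml;
  rewrite (blinD _ _ (blin_bar a0 b0)) (blinZ _ _ (blin_bar a0 b0));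
  rewrite V_relator // mulr0 add0r (blin_sum _ _ (blin_bar a0 b0)) big1 // => g _.
  have [-> ->] : a = [::] /\ b = [::].
    by case: a a0 E => [|[|?] ?] //; case: b b0 => [|[|?] ?].
  by rewrite -mulrA V_nil.
have [l1 [l2 [l3 [l4 [l5 [H K]]]]]] := V_step a0 b0 E.
rewrite -mulrA H; set f := ncder g u * _.
have [|-> -> -> -> ->] := K f; last by rewrite !mulr0 !addr0.
by move=> a' b' a'0 b'0 E'; rewrite /f mulrA IH.
Qed.

Lemma V_descends a b f g : all (leq 1) a -> all (leq 1) b ->
  f - g \in p5_ideal k -> V a b f = V a b g.
Proof.
move=> a0 b0 /asboolP H; have bl := blin_bar a0 b0.
apply/eqP; rewrite -subr_eq0 -(blinB _ _ bl); apply/eqP.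
have [n loc] := bl.2; have [s Hs E] := H n; rewrite (loc _ _ E) {loc E}.
elim: Hs => [|u r v Hr|s1 s2 _ IH1 _ IH2]; first exact: blin0.
  exact: V_ideal.
by rewrite (blinB _ _ bl) IH1 IH2 subrr.
Qed.

End Forms.
End Descent.

Definition lxy : seq nat -> seq nat -> p5fun :=
  bar (w45 k) (w34 k) (w24 k) (w12 k) (w23 k).

(* lxy with w12 and w45, and w23 and w34, exchanged. *)
Definition lyx : seq nat -> seq nat -> p5fun :=
  bar (w12 k) (w23 k) (w24 k) (w45 k) (w34 k).

(* The functional on the completed U(p_5) induced by l, when l vanishes on the
   ideal of relations. *)
Definition p5_eval (l : p5fun) (u : Up5 k) : k := l (repr u).

Lemma omega_arnold (i j l m : 'I_5) : [set i; j] :&: [set l; m] = set0 ->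
  let g := (i, j) in let h := (l, m) in
  [/\ w12 k g * w23 k h = w12 k h * w23 k g,
      w45 k g * w34 k h = w45 k h * w34 k g,
      w45 k g * w24 k h = w45 k h * w24 k g + w12 k h * w24 k g
                          - w12 k g * w24 k h
    & w23 k g * w34 k h = w23 k h * w34 k g
        - (w12 k g - w23 k g + w34 k g) * w24 k h
        + (w12 k h - w23 k h + w34 k h) * w24 k g].
Proof.
pose c r (x y : nat) : int := nth 0 (p5_coord x.+1 y.+1) r.
have check : all (fun x => all (fun y => all (fun z => all (fun t =>
    [&& x != z, x != t, y != z & y != t] ==>
    [&& c 3 x y * c 4 z t == c 3 z t * c 4 x y,
        c 0 x y * c 1 z t == c 0 z t * c 1 x y,
        c 0 x y * c 2 z t == c 0 z t * c 2 x y + c 3 z t * c 2 x y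
                             - c 3 x y * c 2 z t
      & c 4 x y * c 1 z t == c 4 z t * c 1 x y
          - (c 3 x y - c 4 x y + c 1 x y) * c 2 z t
          + (c 3 z t - c 4 z t + c 1 z t) * c 2 x y])
    (iota 0 5)) (iota 0 5)) (iota 0 5)) (iota 0 5) by vm_compute.
move=> D g h.
have dis : [&& val i != val l, val i != val m, val j != val l & val j != val m].
  have {}D x : x \in [set i; j] -> x \in [set l; m] -> False.
    by move=> xi xl; have := in_set0 x; rewrite -D inE xi xl.
  by apply/and4P; split; apply/eqP => /val_inj E;
    [apply: (D i) | apply: (D i) | apply: (D j) | apply: (D j)];
    rewrite !inE ?E eqxx ?orbT.
have I (x : 'I_5) : val x \in iota 0 5 by rewrite mem_iota /=.
have {check} := allP (allP (allP (allP check _ (I i)) _ (I j)) _ (I l)) _ (I m).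
rewrite dis => /and4P[/eqP e1 /eqP e2 /eqP e3 /eqP e4].
by split; rewrite /w12 /w23 /w45 /w34 /w24 /omega /g /h /= -/(c _ _ _)
  -?(intrM, intrB, intrD); congr (_%:~R).
Qed.

Lemma repr_p5 (f : F) :
  repr (\pi_(Quotient.quot (p5_ideal k)) f) - f \in p5_ideal k.
Proof. by rewrite Quotient.idealrBE reprK. Qed.

Lemma lxy_eval a b f : all (leq 1) a -> all (leq 1) b ->
  p5_eval (lxy a b) (\pi_(Quotient.quot (p5_ideal k)) f) = lxy a b f.
Proof.
move=> a0 b0; apply: V_descends => //; try exact: omega_form.
- exact: omega_arnold.
- exact: repr_p5.
Qed.

Lemma lyx_eval a b f : all (leq 1) a -> all (leq 1) b ->
  p5_eval (lyx a b) (\pi_(Quotient.quot (p5_ideal k)) f) = lyx a b f.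
Proof.
move=> a0 b0; apply: V_descends => //; try exact: omega_form.
- move=> i j l m /omega_arnold[e1 e2 e3 e4]; split=> //.
  + by move/eqP: e3; rewrite -subr_eq0 => /eqP e3; apply/eqP;
      rewrite -subr_eq0 -e3; apply/eqP; ring.
  + ring: e3 e4.
- exact: repr_p5.
Qed.

End Bar.

(* Main.v *)
Require Import Defs.
From mathcomp Require Import all_boot all_order all_algebra.
From mathcomp Require Import zify ring boolp.
Import GRing.Theory.
Local Open Scope ring_scope.

Set Implicit Arguments.
Unset Strict Implicit.
Unset Printing Implicit Defensive.

(** Both conditions are statements about the coefficients of psi, and the
    bridge between them is the family of functionals [lyx451 a b], the
    restriction of l^{y,x}_{a,b} to psi_451. On psi_123 every l^{y,x}_{a,b}
    with a nonempty vanishes ([lyx123_eq0]), so psi_123 drops out of the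
    condition (ii). Write [li c] for the signed coefficient of psi at the word
    of the index c.

    The heart of the proof is the product of two polylogarithms. Summing over
    the stuffles of a and b, Li_a(x) Li_b(y) is a sum of Li_c(xy),
    Li_{c,b''}(x, y) and Li_{c,a''}(y, x), where b'' and a'' are the tails left
    over when the other index is exhausted. A product of functionals of
    positive degree kills Lie elements, and on psi_451 the first two kinds of
    terms are plain coefficients [li]. Hence [mixed_lie]: the stuffle sum of
    [li] over (a, b), with [li (c ++ a'')] replaced by [lyx451 c a''] in the
    terms which exhaust b first, is zero. Inverting this triangular relation,
    the stuffle relations for all (a, b) that are not all ones are equivalent
    to [lyx451 c a = li (c ++ a)] for all (c, a) that are not all ones
    ([stuffle_lyx_is_li]). The second half of (ii) moves entries from the
    second index to the first one until it has a single entry, so that only the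
    case of a second index of depth one is left ([lyx_is_li_all]).

    In depth one, [lyx451 a [:: n] = li (rcons a n)] unfolds to
      sum_{W = p x1 q} psi(p (x0 - x1) x0^n x1 q) = psi(x0^n x1 W),
    with W the word of a; the difference of the two sides is [gap n psi W]. For
    n = 0 it is, up to a shuffle with the letter x0, the coefficient of W in
    the reduced coaction equation ([rc_eq_gap]), while a shuffle of W with x0
    turns [gap n] into a multiple of [gap n.+1] ([shuf_gap]). So the gaps for
    n = 0 on all words in which both letters occur, and the gaps for all n on
    words ending in x1, powers of x1 excepted for n = 0, carry the same
    information ([gap_words]).

    What remains are the stuffle relations between all-ones indices: they
    follow from the others because of the correction term psi_corr, through
    Newton's identities for elementary symmetric functions and the
    associativity of the stuffle product ([stuf_all]).

    Throughout, the entry n of a sequence stands for n + 1, so that every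
    sequence is an index, all ones means all zeros, and merging the entries a
    and b gives (a + b).+1. *)

(** * The shuffle product and Lie series *)

(** The sum of f over the shuffles of u and v, as a functional of f: peeling
    the first letter then amounts to the shift [f \o cons a]. *)
Fixpoint shuf (k : fieldType) (X : Type) (u : seq X) :
    seq X -> (seq X -> k) -> k :=
  if u is a :: u' then
    fix shuf_u v f := if v is b :: v' then
        shuf u' v (f \o cons a) + shuf_u v' (f \o cons b)
      else f u
  else fun v f => f v.
Arguments shuf : simpl never.

Section Shuffle.
Variables (k : fieldType) (X : Type).
Implicit Types (u v w : seq X) (f g : seq X -> k).

Lemma shuf_nil v f : shuf [::] v f = f v. Proof. by []. Qed.

Lemma shuf0 u f : shuf u [::] f = f u. Proof. by case: u. Qed.

Lemma shuf_cons a u b v f : shuf (a :: u) (b :: v) f =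
  shuf u (b :: v) (f \o cons a) + shuf (a :: u) v (f \o cons b).
Proof. by []. Qed.

Lemma shuf_lin c u v f g :
  shuf u v (fun w => c * f w + g w) = c * shuf u v f + shuf u v g.
Proof.
elim: u v f g => [//|a u IHu] v f g.
elim: v f g => [//|b v IHv] f g.
have shift x : (fun w => c * f w + g w) \o cons x
  = (fun w => c * (f \o cons x) w + (g \o cons x) w) by [].
rewrite !shuf_cons !shift IHu IHv; ring.
Qed.

Lemma shufD u v f g : shuf u v (fun w => f w + g w) = shuf u v f + shuf u v g.
Proof.
rewrite -[shuf u v f]mul1r -shuf_lin; congr shuf.
by apply/funext => w; rewrite mul1r.
Qed.

Lemma shufC0 u v : shuf u v (fun=> 0 : k) = 0.
Proof.
have E : (fun _ : seq X => 0 + 0) = fun=> 0 : k.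
  by apply/funext => w; rewrite addr0.
have /eqP := shufD u v (fun=> 0 : k) (fun=> 0).
by rewrite E -subr_eq0 opprD addNKr oppr_eq0 => /eqP.
Qed.

Lemma shufZ c u v f : shuf u v (fun w => c * f w) = c * shuf u v f.
Proof.
rewrite -[RHS]addr0 -(shufC0 u v) -shuf_lin.
by congr shuf; apply/funext => w; rewrite addr0.
Qed.

Lemma shuf1_cons x y v f :
  shuf [:: x] (y :: v) f = f (x :: y :: v) + shuf [:: x] v (f \o cons y).
Proof. by []. Qed.

Lemma shuf1_eq0 x v f : (forall p q, p ++ q = v -> f (p ++ x :: q) = 0) ->
  shuf [:: x] v f = 0.
Proof.
elim: v f => [|y v IH] f H; first exact: (H [::] [::]).
rewrite shuf1_cons (H [::]) // add0r IH // => p q E.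
by apply: (H (y :: p)); rewrite /= E.
Qed.

Lemma shuf1_nseq x n f : shuf [:: x] (nseq n x) f = n.+1%:R * f (nseq n.+1 x).
Proof.
elim: n f => [|n IH] f; first by rewrite mul1r.
by rewrite shuf1_cons IH [n.+2%:R]mulrS mulrDl mul1r.
Qed.

End Shuffle.

Section Primitive.
Variables (k : fieldType) (X : eqType).
Implicit Types (u v w : seq X) (f g : ncps X k).

(** The functional of a shuffle is multiplicative along deconcatenation: this
    is the compatibility of the shuffle coproduct with concatenation. *)
Lemma shuf_mul f g u v : shuf u v (f * g : ncps X k) =
  \sum_(i < (size u).+1) \sum_(j < (size v).+1)
    shuf (take i u) (take j v) f * shuf (drop i u) (drop j v) g.
Proof.
have derM (f' : ncps X k) a : (f' * g : ncps X k) \o cons a =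
    (fun w => f' [::] * (g \o cons a) w + (ncder a f' * g : ncps X k) w).
  by apply/funext => w; rewrite /= -ncM_cons.
elim: u v f => [|a u IHu] v f.
  rewrite big_ord_recl big_ord0 addr0 shuf_nil ncME.
  by apply: eq_bigr.
elim: v f => [|b v IHv] f.
  rewrite shuf0 ncME; apply: eq_bigr => i _.
  by rewrite big_ord_recl big_ord0 addr0 !shuf0.
rewrite shuf_cons !derM !shuf_lin IHu IHv.
rewrite [X in _ + _ + (_ + X)]big_ord_recl [X in _ = X]big_ord_recl.
rewrite [X in _ = X + _]big_ord_recl.
under [X in _ + X + _]eq_bigr => i _ do rewrite big_ord_recl.
under [X in _ = _ + X]eq_bigr => i _ do rewrite big_ord_recl.
rewrite !big_split /=.
under [X in _ = _ + (_ + X)]eq_bigr => i _ do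
  under eq_bigr => j _ do rewrite shuf_cons mulrDl.
under [X in _ = _ + (_ + X)]eq_bigr => i _ do rewrite big_split.
under [X in _ + (X + _) + _]eq_bigr => i _ do rewrite shuf0.
rewrite big_split /=.
have reorder (x A B P1 P2 Q1 Q2 : k) : x * A + (P1 + P2) + (x * B + (Q1 + Q2))
    = x * (A + B) + Q1 + (P1 + (P2 + Q2)) by ring.
exact: reorder.
Qed.

Definition primitive f := f [::] = 0 /\
  forall u v, u != [::] -> v != [::] -> shuf u v f = 0.

Lemma shuf_mul_primitive f g u v : primitive f -> primitive g ->
  u != [::] -> v != [::] ->
  shuf u v (f * g : ncps X k) = f u * g v + f v * g u.
Proof.
move=> [f0 Pf] [g0 Pg] u0 v0; rewrite shuf_mul.
case: u u0 => [//|a u] u0; case: v v0 => [//|b v] v0.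
rewrite big_ord_recl [X in X + _]big_ord_recr [X in _ + X]big_ord_recr.
rewrite [X in _ + (_ + X)]big_ord_recl.
rewrite !take_size !drop_size !take0 !drop0 !shuf_nil !shuf0.
rewrite [X in X + _ + _]big1 ?add0r => [|j _]; last first.
  rewrite Pg ?mulr0 // -size_eq0 size_drop subn_eq0 -ltnNge.
  exact: ltn_ord j.
rewrite [X in _ + (X + _)]big1 ?add0r => [|i _]; last first.
  apply: big1 => j _; case: (eqVneq (take j (b :: v)) [::]) => [E|jv].
    have -> : drop j (b :: v) = b :: v by rewrite -[RHS](cat_take_drop j) E.
    rewrite Pg ?mulr0 // -size_eq0 size_drop subn_eq0 -ltnNge lift0.
    exact: ltn_ord i.
  by rewrite Pf ?mul0r.
rewrite big1 ?addr0 => [|j _]; last by rewrite Pf ?mul0r.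
rewrite lift0 -[(nat_of_ord _).+1]/(size (a :: u)) take_size drop_size.
by rewrite shuf_nil addrC.
Qed.

Lemma shuf_ext u v (f g : seq X -> k) :
    (forall w, size w = (size u + size v)%N -> f w = g w) ->
  shuf u v f = shuf u v g.
Proof.
elim: u v f g => [|a u IHu] v f g fg; first exact: fg.
elim: v f g fg => [|b v IHv] f g fg; first by rewrite !shuf0 fg //= addn0.
rewrite !shuf_cons; congr (_ + _).
  by apply: IHu => w sw; apply: fg; rewrite /= sw.
by apply: IHv => w sw; apply: fg; rewrite /= sw addnS.
Qed.

Lemma lie_poly_primitive f : lie_poly f -> primitive f.
Proof.
elim=> {f} [x|f g _ [f0 Pf] _ [g0 Pg]|c f _ [f0 Pf]|f g _ Pf _ Pg].
- split=> // u v u0 v0; rewrite -[RHS](shufC0 k u v).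
  apply: shuf_ext => w sw; rewrite ncwordE; case: eqP => // E.
  by move: sw u0 v0; rewrite E -!size_eq0 /=; lia.
- split=> [|u v u0 v0]; first by rewrite ncDE f0 g0 addr0.
  by rewrite [LHS]shufD Pf // Pg // addr0.
- split=> [|u v u0 v0]; first by rewrite ncZE f0 mulr0.
  by rewrite [LHS]shufZ Pf // mulr0.
have [[f0 _] [g0 _]] := (Pf, Pg).
split=> [|u v u0 v0]; first by rewrite ncBE !ncM_nil f0 g0 mul0r subrr.
have -> : ncoef (ncbr f g) =
    fun w => -1 * (g * f : ncps X k) w + (f * g : ncps X k) w.
  by apply/funext => w; rewrite ncBE mulN1r addrC.
by rewrite shuf_lin !shuf_mul_primitive //; ring.
Qed.

(** Only the homogeneous part of degree |u| + |v| of f contributes, and it is a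
    Lie polynomial. *)
Lemma shuf_lie f u v : lie_series f -> u != [::] -> v != [::] ->
  shuf u v f = 0.
Proof.
move=> Lf u0 v0.
have [_ P] := lie_poly_primitive (Lf (size u + size v)%N).
rewrite -(P u v u0 v0).
by apply: shuf_ext => w sw; rewrite /= sw eqxx.
Qed.

Lemma lie_nil f : lie_series f -> f [::] = 0.
Proof. by move=> Lf; have [] := lie_poly_primitive (Lf 0%N). Qed.

End Primitive.
(** * The stuffle product *)

(** The functional version of the quasi-shuffle product of the words in the
    y_n, as for [shuf]. *)
Fixpoint stuf (k : fieldType) (u : seq nat) : seq nat -> (seq nat -> k) -> k :=
  if u is a :: u' then
    fix stuf_u v f := if v is b :: v' then
        stuf u' v (f \o cons a) + stuf_u v' (f \o cons b)
        + stuf u' v' (f \o cons (a + b).+1)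
      else f u
  else fun v f => f v.
Arguments stuf : simpl never.

Section Stuffle.
Variable k : fieldType.
Implicit Types (u v w : seq nat) (f g : seq nat -> k).

Lemma stuf_nil v f : stuf [::] v f = f v. Proof. by []. Qed.

Lemma stuf0 u f : stuf u [::] f = f u. Proof. by case: u. Qed.

Lemma stuf_cons a u b v f : stuf (a :: u) (b :: v) f =
  stuf u (b :: v) (f \o cons a) + stuf (a :: u) v (f \o cons b)
  + stuf u v (f \o cons (a + b).+1).
Proof. by []. Qed.

Lemma stufD u v f g : stuf u v (fun w => f w + g w) = stuf u v f + stuf u v g.
Proof.
elim: u v f g => [//|a u IHu] v f g.
elim: v f g => [//|b v IHv] f g.
rewrite !stuf_cons.
have D c : (fun w => f w + g w) \o cons c
  = (fun w => (f \o cons c) w + (g \o cons c) w) by [].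
rewrite !D !IHu IHv; ring.
Qed.

(** Merging two entries raises the sum of the (shifted) entries by one, and a
    word of the stuffle is at least as long as each of its factors. *)
Lemma stuf_ext u v f g :
    (forall w, (sumn u + sumn v <= sumn w)%N -> (size u <= size w)%N ->
       f w = g w) ->
  stuf u v f = stuf u v g.
Proof.
elim: u v f g => [|a u IHu] v f g fg; first by apply: fg.
elim: v f g fg => [|b v IHv] f g fg; first by rewrite !stuf0 fg //= addn0.
rewrite !stuf_cons; congr (_ + _ + _); [apply: IHu|apply: IHv|apply: IHu] => w;
  by move=> sw zw; apply: fg => /=; move: sw zw => /=; lia.
Qed.

(** The stuffle product can be computed from the last letters as well; the
    coproduct Delta_* unfolds a word from the left and the polylogarithms from
    the right. *)
Lemma stuf_rcons u a v b f : stuf (rcons u a) (rcons v b) f =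
  stuf u (rcons v b) (f \o rcons^~ a) + stuf (rcons u a) v (f \o rcons^~ b)
  + stuf u v (f \o rcons^~ (a + b).+1).
Proof.
have com h c d : (h \o rcons^~ d) \o cons c
  = (h \o cons c) \o rcons^~ d :> (seq nat -> k) by [].
elim: u v f => [|c u IHu] v f.
  elim: v f => [|d v IHv] f.
    rewrite stuf_cons !stuf_nil !stuf0 /=; ring.
  rewrite !rcons_cons stuf_cons IHv !stuf_nil /= stuf_cons !stuf_nil /=; ring.
elim: v f => [|d v IHv] f.
  have IH0 h : stuf (rcons u a) [:: b] h = _ := IHu [::] h.
  rewrite rcons_cons /= stuf_cons IH0 stuf_cons !stuf0 !com /=; ring.
rewrite !rcons_cons stuf_cons -!rcons_cons IHu IHv IHu !rcons_cons !stuf_cons.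
rewrite !com; ring.
Qed.

Lemma stuf_rev u v f : stuf (rev u) (rev v) f = stuf u v (f \o rev).
Proof.
elim: u v f => [|a u IHu] v f; first by [].
elim: v f => [|b v IHv] f; first by rewrite !stuf0.
have com h c : (h \o rcons^~ c) \o rev = (h \o rev) \o cons c :> (seq nat -> k).
  by apply/funext => w /=; rewrite rev_cons.
by rewrite !rev_cons stuf_rcons -!rev_cons IHu IHv IHu stuf_cons !com.
Qed.

(** Associativity, by comparison of the seven possible first letters. *)
Lemma stufA u v w f :
  stuf u v (fun x => stuf x w f) = stuf v w (fun x => stuf u x f).
Proof.
elim: u v w f => [//|a u IHu] v w f.
elim: v w f => [//|b v IHv] w f.
elim: w f => [|c w IHw] f.
  by rewrite stuf0; congr stuf; apply/funext => x; rewrite stuf0.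
have L d : (fun x => stuf x (c :: w) f) \o cons d = (fun x =>
     stuf x (c :: w) (f \o cons d) + stuf (d :: x) w (f \o cons c)
     + stuf x w (f \o cons (d + c).+1)) by [].
have R d : (fun x => stuf (a :: u) x f) \o cons d = (fun x =>
     stuf u (d :: x) (f \o cons a) + stuf (a :: u) x (f \o cons d)
     + stuf u x (f \o cons (a + d).+1)) by [].
rewrite stuf_cons [RHS]stuf_cons !L !R !stufD.
rewrite !addSn !addnS addnA !IHu IHv.
have Ea : stuf (b :: v) (c :: w) (fun x => stuf u x (f \o cons a)) =
    stuf v (c :: w) (fun x => stuf u (b :: x) (f \o cons a))
    + stuf (b :: v) w (fun x => stuf u (c :: x) (f \o cons a))
    + stuf v w (fun x => stuf u ((b + c).+1 :: x) (f \o cons a)) by [].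
have Ec : stuf u (b :: v) (fun x => stuf (a :: x) w (f \o cons c))
    + stuf (a :: u) v (fun x => stuf (b :: x) w (f \o cons c))
    + stuf u v (fun x => stuf ((a + b).+1 :: x) w (f \o cons c))
    = stuf (b :: v) w (fun x => stuf (a :: u) x (f \o cons c)) by exact: IHw.
rewrite Ea -Ec !IHv; ring.
Qed.
End Stuffle.

Section SumWords.

Lemma sum_words_cons (X : finType) (V : nmodType) M (G : seq X -> V) :
  \sum_(m < M.+1) \sum_(w : m.-tuple X) G w =
  G [::] + \sum_x \sum_(m < M) \sum_(w : m.-tuple X) G (x :: w).
Proof.
rewrite big_ord_recl; congr (_ + _).
  by rewrite (big_pred1 [tuple]) // => w; rewrite [w]tuple0; apply/esym/eqP.
rewrite exchange_big; apply: eq_bigr => m _ /=.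
rewrite pair_big (reindex (fun p : X * m.-tuple X => [tuple of p.1 :: p.2])).
  by apply: eq_bigr => -[x w] _.
exists (fun w => (thead w, [tuple of behead w])) => [[x w] _|w _].
  by congr pair; apply/val_inj.
by case/tupleP: w => x w; apply/val_inj.
Qed.

End SumWords.

Section DeltaStar.
Variable k : fieldType.
Implicit Types (u v w : seq nat) (f : seq nat -> k).

Lemma yser0 u : yser k 0 u = (u == [::])%:R. Proof. by []. Qed.
Lemma yserS n u : yser k n.+1 u = (u == [:: n])%:R. Proof. by []. Qed.

Lemma delta_y_nil n v : delta_y k n.+1 [::] v = (v == [:: n])%:R.
Proof.
rewrite /delta_y /tens big_ord_recl big1 ?addr0 => [|i _].
  by rewrite subn0 yser0 yserS mul1r.
by rewrite lift0 yserS mul0r.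
Qed.

Lemma delta_y_nilr n u : delta_y k n.+1 u [::] = (u == [:: n])%:R.
Proof.
rewrite /delta_y /tens big_ord_recr big1 ?add0r => [|i _] /=.
  by rewrite add0r subnn yser0 mulr1.
by rewrite subSn ?yserS ?mulr0 // -ltnS.
Qed.

Lemma delta_y_cons n a u b v : delta_y k n.+1 (a :: u) (b :: v) =
  ((u == [::]) && (v == [::]) && (n == (a + b).+1))%:R.
Proof.
rewrite /delta_y /tens big_ord_recl yser0 mul0r add0r.
have E (i : 'I_n.+1) :
  yser k (lift ord0 i) (a :: u) * yser k (n.+1 - lift ord0 i) (b :: v) =
  ((val i == a) && ((u == [::]) && (v == [::]) && (n == (a + b).+1)))%:R.
  rewrite lift0 yserS subSS eqseq_cons eq_sym -/(val i).
  case: (leqP n i) => ni.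
    have -> : (n - i = 0)%N by apply/eqP; rewrite subn_eq0.
    rewrite yser0 mulr0; case: (nat_of_ord i =P a) => //= ia.
    by case: (n =P _) => nab; [exfalso; lia | rewrite andbF].
  rewrite -(subnSK ni) yserS eqseq_cons -natrM mulnb.
  case: (nat_of_ord i =P a) => //= ia.
  have -> : (b == n - i.+1)%N = (n == (a + b).+1) by apply/eqP/eqP; lia.
  by rewrite [_ && (v == _)]andbC andbA.
rewrite (eq_bigr _ (fun i _ => E i)); case: (ltnP a n.+1) => an.
  rewrite (bigD1 (Ordinal an)) //= eqxx big1 ?addr0 // => i.
  by rewrite -val_eqE => /= /negbTE->.
rewrite big1 => [|i _].
  by rewrite (_ : (n == (a + b).+1) = false) ?andbF //; apply/eqP; lia.
by case: (nat_of_ord i =P a) => // ia; have := ltn_ord i; lia.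
Qed.

(** The possible first letters of a word of the stuffle of u and v, each with
    the two words that are left to be stuffled after it. *)
Definition first_letters u v : seq (nat * (seq nat * seq nat)) :=
  match u, v with
  | a :: u', b :: v' => [:: (a, (u', v)); (b, (u, v')); ((a + b).+1, (u', v'))]
  | a :: u', [::] => [:: (a, (u', [::]))]
  | [::], b :: v' => [:: (b, ([::], v'))]
  | [::], [::] => [::]
  end.

Lemma stuf_first u v f : stuf u v f = f [::] * ((u == [::]) && (v == [::]))%:R
  + \sum_(s <- first_letters u v) stuf s.2.1 s.2.2 (f \o cons s.1).
Proof.
case: u v => [|a u] [|b v]; rewrite /= ?big_cons big_nil;
  rewrite ?mulr1 ?mulr0 ?add0r ?addr0 //.
- by rewrite !stuf0.
- by rewrite stuf_cons /= addrA.
Qed.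

Lemma delta_word_cons n w u v : delta_word k (n :: w) u v =
  \sum_(s <- first_letters u v) (s.1 == n)%:R * delta_word k w s.2.1 s.2.2.
Proof.
rewrite /delta_word /= -/(delta_word k w); move: (delta_word k w) => t.
have long (T : Type) (s : seq T) (i : 'I_(size s)) : nilp (take i.+1 s) = false.
  by rewrite /nilp size_takel.
have nilE (s : seq nat) : (s == [::]) = nilp s by case: s.
rewrite /tens_mul; case: u => [|a u]; case: v => [|b v].
- by rewrite big_nil !big_ord1 delta_y_nil mul0r.
- rewrite big_cons big_nil big_ord1 take0 drop0 big_ord_recl delta_y_nil mul0r.
  rewrite big_ord_recl big1 => [|j _].
    by rewrite delta_y_nil /= take0 drop0 eqseq_cons andbT; ring.
  by rewrite delta_y_nil !lift0 /= eqseq_cons nilE long andbF mul0r.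
- rewrite big_cons big_nil big_ord_recl big_ord1 delta_y_nil mul0r.
  rewrite big_ord_recl big_ord1 big1 => [|j _].
    by rewrite delta_y_nilr /= take0 drop0 eqseq_cons andbT; ring.
  by rewrite big_ord1 delta_y_nilr !lift0 /= eqseq_cons nilE long andbF mul0r.
rewrite !big_cons big_nil /=.
rewrite [LHS]big_ord_recl [X in _ + X]big_ord_recl.
rewrite [X in _ + (_ + X) = _]big1; last first.
  move=> i _; rewrite big1 // => -[[|j] lj] _; rewrite !lift0 /=.
    by rewrite delta_y_nilr eqseq_cons nilE long andbF mul0r.
  by rewrite delta_y_cons nilE long mul0r.
have -> : \sum_(j < (size v).+2)
    delta_y k n.+1 (take (@ord0 (size u).+1) (a :: u)) (take j (b :: v)) *
    t (drop (@ord0 (size u).+1) (a :: u)) (drop j (b :: v))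
    = (b == n)%:R * t (a :: u) v.
  rewrite big_ord_recl delta_y_nil mul0r big_ord_recl big1 => [|j _].
    by rewrite delta_y_nil /= take0 drop0 eqseq_cons andbT; ring.
  by rewrite delta_y_nil !lift0 /= eqseq_cons nilE long andbF mul0r.
rewrite [X in _ + (X + _) = _]big_ord_recl delta_y_nilr.
rewrite [X in _ + (_ + X + _) = _]big_ord_recl big1 => [|j _].
  have take1 (x : nat) s : take 1 (x :: s) = [:: x] by rewrite /= take0.
  have drop1 (x : nat) s : drop 1 (x :: s) = s by rewrite /= drop0.
  rewrite !lift0 !take1 !drop1 delta_y_cons drop0 eqseq_cons !eqxx andbT.
  rewrite [n == _]eq_sym; ring.
by rewrite !lift0 delta_y_cons (nilE (take j.+1 v)) long andbF mul0r.
Qed.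

Definition weight u : nat := \sum_(n <- u) n.+1.

Lemma weight_cons n u : weight (n :: u) = (n.+1 + weight u)%N.
Proof. exact: big_cons. Qed.

Lemma first_letters_bound u v s : s \in first_letters u v ->
  [/\ (s.1 < weight u + weight v)%N,
      (size s.2.1 + size s.2.2 < size u + size v)%N
    & (weight s.2.1 + weight s.2.2 <= weight u + weight v)%N].
Proof.
case: u v => [|a u] [|b v]; rewrite ?in_nil ?inE //;
  first [move/eqP-> | case/or3P=> /eqP->];
  by rewrite /= ?weight_cons; split; lia.
Qed.

(** The duality between Delta_* and the stuffle product: any bounds on the
    letters and on the length that contain the words of the stuffle will do. *)
Lemma delta_word_sum N M f u v : (size u + size v <= M)%N ->
    (weight u + weight v <= N)%N ->
  \sum_(m < M.+1) \sum_(w : m.-tuple 'I_N)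
     f [seq val i | i <- w] * delta_word k [seq val i | i <- w] u v
  = stuf u v f.
Proof.
elim: M f u v => [|M IH] f u v sM wN;
  rewrite (sum_words_cons _ (fun w : seq 'I_N => f [seq val i | i <- w] *
    delta_word k [seq val i | i <- w] u v)) stuf_first.
all: rewrite {1}/delta_word /= /tens !nc1E -natrM mulnb; congr (_ + _).
  rewrite big1 => [|i _]; last exact: big_ord0.
  by case: u v sM {wN} => [|//] [|//]; rewrite big_nil.
under eq_bigr => i _.
  under eq_bigr => m _.
    under eq_bigr => w _ do rewrite delta_word_cons mulr_sumr.
    rewrite exchange_big; over.
  rewrite exchange_big; over.
rewrite exchange_big; apply: eq_big_seq => s /first_letters_bound[sN ss sw].
rewrite (bigD1 (Ordinal (leq_trans sN wN))) //=.
rewrite [X in _ + X]big1 ?addr0 => [|i]; last first.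
  rewrite -val_eqE eq_sym => /= /negbTE ne; rewrite big1 // => m _.
  by rewrite big1 // => w _; rewrite ne mul0r mulr0.
rewrite -IH ?(leq_trans sw) //; last by rewrite -ltnS (leq_trans ss).
apply: eq_bigr => m _; apply: eq_bigr => w _.
by rewrite eqxx mul1r.
Qed.

Lemma delta_starE (f : ncps nat k) u v : delta_star f u v = stuf u v f.
Proof.
have size_weight s : (size s <= weight s)%N.
  by elim: s => //= n s; rewrite weight_cons; lia.
rewrite /delta_star big_cat; apply: delta_word_sum => //.
exact: leq_add (size_weight u) (size_weight v).
Qed.

End DeltaStar.
(** * Stuffle relations between all-ones indices *)

Section AllOnes.
Variable k : fieldType.
Hypothesis char0 : [pchar k] =i pred0.
Implicit Types (u v w : seq nat) (f g : seq nat -> k).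

Lemma natr_neq0 n : n.+1%:R != 0 :> k.
Proof. by move/pcharf0P: char0 => ->. Qed.

Lemma sumn_eq0 u : sumn u = 0%N -> u = nseq (size u) 0%N.
Proof.
elim: u => //= a u IH /eqP; rewrite addn_eq0 => /andP[/eqP-> /eqP/IH E].
by rewrite {1}E.
Qed.

Lemma stufC0 u v : stuf u v (fun=> 0 : k) = 0.
Proof.
have E : (fun _ : seq nat => 0 + 0) = fun=> 0 : k.
  by apply/funext => w; rewrite addr0.
have /eqP := stufD u v (fun=> 0 : k) (fun=> 0).
by rewrite E -subr_eq0 opprD addNKr oppr_eq0 => /eqP.
Qed.

(** In terms of symmetric functions, p_{i+1} e_{m+1} is the sum of two monomial
    functions: either p_{i+1} stays alone, or it merges with one of the ones. *)
Lemma stuf1_nseq i m f : stuf [:: i] (nseq m.+1 0%N) f =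
  shuf [:: i] (nseq m.+1 0%N) f + shuf [:: i.+1] (nseq m 0%N) f.
Proof.
elim: m f => [|m IH] f.
  by rewrite stuf_cons shuf_cons !stuf_nil !stuf0 !shuf_nil !shuf0 addn0.
rewrite [LHS]stuf_cons IH [X in _ = X + _]shuf1_cons [X in _ = _ + X]shuf1_cons.
by rewrite !stuf_nil /= addn0; ring.
Qed.

(** S_ones is Newton's identity n e_n = (-1)^(n-1) p_n modulo the products that
    S is already known to kill. *)
Variable S : seq nat -> k.
Hypothesis S_stuf : forall u v, u != [::] -> v != [::] ->
  (0 < sumn u + sumn v)%N -> stuf u v S = 0.
Hypothesis S_ones : forall m,
  m.+2%:R * S (nseq m.+2 0%N) = (-1) ^+ m.+1 * S [:: m.+1].

Lemma shuf_ones i m :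
  shuf [:: i.+1] (nseq m 0%N) S = (-1) ^+ m * S [:: (i + m).+1].
Proof.
elim: m i => [|m IH] i; first by rewrite mul1r addn0 shuf0.
have /eqP := S_stuf (u := [:: i.+1]) (v := nseq m.+1 0%N) isT isT isT.
rewrite stuf1_nseq IH addr_eq0 => /eqP->.
by rewrite exprS mulN1r mulNr addnS.
Qed.

Lemma stuf_one w : w != [::] -> stuf [:: 0%N] w S = 0.
Proof.
case: (posnP (sumn w)) => [/sumn_eq0-> | w0]; last by move=> ?; apply: S_stuf.
case: (size w) => [//|m] _; rewrite stuf1_nseq shuf1_nseq S_ones shuf_ones.
by rewrite exprS mulN1r mulNr addNr.
Qed.

(** The induction replaces e_{n+2} by e_1 e_{n+1}, which is (n + 2) e_{n+2}
    plus words that are not all ones, and moves the factor e_1 to the other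
    side of the product by associativity. *)
Lemma stuf_ones n m : stuf (nseq n.+1 0%N) (nseq m.+1 0%N) S = 0.
Proof.
elim: n => [|n IH]; first exact: stuf_one.
pose G w := stuf w (nseq m.+1 0%N) S.
have : stuf [:: 0%N] (nseq n.+1 0%N) G = 0.
  rewrite stufA -[RHS](stufC0 (nseq n.+1 0%N) (nseq m.+1 0%N)).
  by apply: stuf_ext => -[//|c w] _ _; apply: stuf_one.
rewrite stuf1_nseq shuf1_nseq shuf1_eq0 ?addr0 => [/eqP|p q _].
  by rewrite mulf_eq0 (negbTE (natr_neq0 _)) => /eqP.
by apply: S_stuf; rewrite -?size_eq0 ?sumn_cat ?size_cat //= ?addnS //; lia.
Qed.

Lemma stuf_all u v : u != [::] -> v != [::] -> stuf u v S = 0.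
Proof.
case: (posnP (sumn u + sumn v)) => [/eqP|]; last by move=> *; apply: S_stuf.
rewrite addn_eq0 => /andP[/eqP/sumn_eq0-> /eqP/sumn_eq0->].
by case: (size u) => [//|n]; case: (size v) => [//|m] _ _; apply: stuf_ones.
Qed.

End AllOnes.

(** * The functionals l^{y,x} on psi_451 and psi_123 *)

Section Words.
Variable k : fieldType.
Implicit Types (a b c : seq nat) (w : seq bool) (f : seq bool -> k).

Definition index_word a : seq bool := flatten [seq zword n.+1 | n <- rev a].

Lemma index_word_rcons a p :
  index_word (rcons a p) = nseq p false ++ true :: index_word a.
Proof. by rewrite /index_word rev_rcons /= /zword -cats1 -catA. Qed.

Definition li a f : k := (-1) ^+ size a * f (index_word a).

Lemma li_rconsS a p f : li (rcons a p.+1) f = li (rcons a p) (f \o cons false).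
Proof. by rewrite /li !index_word_rcons !size_rcons. Qed.

Lemma li_rcons0 a f : li (rcons a 0%N) f = - li a (f \o cons true).
Proof. by rewrite /li !index_word_rcons !size_rcons exprS mulN1r mulNr. Qed.

End Words.

Section Substitution.
Variables (k : fieldType) (Y : eqType) (g h : Y).
Implicit Types (f : ncps bool k).
Local Notation ev f := (ev2 f (ncvar k g) (ncvar k h)).

Lemma ev2_nil f : ev f [::] = f [::].
Proof.
rewrite /ev2 /ncsubst /ncext [LHS]/= (sum_words_cons 0 (fun u : seq bool =>
  f u * (\prod_(x <- u) (if x then ncvar k h else ncvar k g)) [::])).
rewrite big_nil nc1E mulr1 big1 ?addr0 // => x _; exact: big_ord0.
Qed.

Lemma ev2_cons f y w : ev f (y :: w) =
  (y == g)%:R * ev (ncder false f) w + (y == h)%:R * ev (ncder true f) w.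
Proof.
rewrite /ev2 /ncsubst /ncext [LHS]/= (sum_words_cons _ (fun u : seq bool =>
  f u * (\prod_(x <- u) (if x then ncvar k h else ncvar k g)) (y :: w))).
rewrite big_nil nc1E mulr0 add0r big_bool addrC; congr (_ + _).
  rewrite mulr_sumr; apply: eq_bigr => m _; rewrite mulr_sumr.
  by apply: eq_bigr => u _; rewrite big_cons ncvarM_cons mulrCA.
rewrite mulr_sumr; apply: eq_bigr => m _; rewrite mulr_sumr.
by apply: eq_bigr => u _; rewrite big_cons ncvarM_cons mulrCA.
Qed.

Lemma ev2_var f : ev f = f [::] *: 1 +
  (ncvar k g * ev (ncder false f) + ncvar k h * ev (ncder true f)).
Proof.
apply/ncpsP => -[|y w]; rewrite !ncDE ncZE nc1E.
  by rewrite ev2_nil !ncvarM_nil mulr1 !addr0.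
by rewrite ev2_cons !ncvarM_cons mulr0 add0r.
Qed.

End Substitution.

Section Bar.
Variable k : fieldType.

Lemma bar_one o45 o34 o24 o12 o23 a b : all (leq 1) a -> all (leq 1) b ->
  (a != [::]) || (b != [::]) -> bar (k := k) o45 o34 o24 o12 o23 a b 1 = 0.
Proof.
have cons1 u l : bounded_linear l -> barcons (k := k) u l 1 = 0.
  move=> bl; rewrite -[RHS](blin0 bl); congr l; apply/ncpsP => w /=.
  by rewrite big1 // => x _; rewrite mulr0.
have bar1_one u v c : all (leq 1) c -> c != [::] -> bar1 (k := k) u v c 1 = 0.
  case/lastP: c => // c [|[|p]]; rewrite ?all_rcons // => _ _.
    by rewrite bar1_rcons1 cons1 ?oppr0 //; apply: blin_bar1.
  by rewrite bar1_rconsS cons1 //; apply: blin_bar1.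
move=> a0 b0; case: (eqVneq a [::]) => [->|na].
  by move=> nb; rewrite bar0l bar1_one.
case: (eqVneq b [::]) => [->|nb] _; first by rewrite bar0r // bar1_one.
have ia : is_index a by rewrite /is_index na.
have ib : is_index b by rewrite /is_index nb.
have bl a' b' := @blin_bar k o45 o34 o24 o12 o23 a' b'.
have fa := all_front a0; have fb := all_front b0.
have [c0 t0] : all (leq 1) (rcons (front a) (head 0%N b)) /\
    all (leq 1) (behead b).
  by case: (b) nb b0 => //= q b' _ /andP[q0 b'0]; rewrite all_rcons q0 fa.
rewrite barE //; case: ifPn => [h|_]; case: ifPn => [h'|_];
  rewrite !cons1 ?oppr0 ?addr0 //; apply: bl => //;
  by [have /andP[] := index_decr ia h | have /andP[] := index_decr ib h'].
Qed.

Variables g h : p5letter.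
Implicit Types (a b c : seq nat) (f : seq bool -> k).

(** l^{y,x}_{a,b} on f(x_g, x_h), as a functional of the coefficients of f. *)
Definition lyx_word a b f : k := lyx [seq n.+1 | n <- a] [seq n.+1 | n <- b]
  (ev2 (NCps f) (ncvar k g) (ncvar k h)).

Let step a b x f : k := lyx [seq n.+1 | n <- a] [seq n.+1 | n <- b]
  (ncvar k x * ev2 (NCps f) (ncvar k g) (ncvar k h)).

Lemma all_succ a : all (leq 1) [seq n.+1 | n <- a].
Proof. by rewrite all_map; apply/allP. Qed.

Lemma lyx_word_step a b f : (a != [::]) || (b != [::]) ->
  lyx_word a b f = step a b g (f \o cons false) + step a b h (f \o cons true).
Proof.
move=> ab; rewrite /lyx_word ev2_var.
have bl : bounded_linear (lyx (k := k) [seq n.+1 | n <- a] [seq n.+1 | n <- b]).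
  by apply: blin_bar; apply: all_succ.
rewrite !(blinD _ _ bl) (blinZ _ _ bl) [X in _ * X]bar_one ?mulr0 ?add0r //.
- exact: all_succ.
- exact: all_succ.
- by case: (a) (b) ab => [|? ?] [|? ?].
Qed.

Lemma lyx_word_nil f : lyx_word [::] [::] f = f [::].
Proof. by rewrite /lyx_word /lyx bar0l bar1_nil /bar0 ev2_nil. Qed.

Lemma lyx_word_r0S a p f : lyx_word (rcons a p.+1) [::] f =
  (w45 k g + w12 k g) * lyx_word (rcons a p) [::] (f \o cons false)
  + (w45 k h + w12 k h) * lyx_word (rcons a p) [::] (f \o cons true).
Proof.
rewrite lyx_word_step -?size_eq0 ?size_rcons // /step /lyx_word !map_rcons /lyx.
by rewrite !V_r0S.
Qed.

Lemma lyx_word_r01 a f : lyx_word (rcons a 0%N) [::] f =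
  - (w24 k g * lyx_word a [::] (f \o cons false)
     + w24 k h * lyx_word a [::] (f \o cons true)).
Proof.
rewrite lyx_word_step -?size_eq0 ?size_rcons // /step /lyx_word !map_rcons /lyx.
by rewrite !V_r01 opprD.
Qed.

Lemma lyx_word_l0S b q f : lyx_word [::] (rcons b q.+1) f =
  w12 k g * lyx_word [::] (rcons b q) (f \o cons false)
  + w12 k h * lyx_word [::] (rcons b q) (f \o cons true).
Proof.
rewrite lyx_word_step -?size_eq0 ?size_rcons ?orbT // /step /lyx_word.
by rewrite !map_rcons /lyx !V_l0S ?all_succ.
Qed.

Lemma lyx_word_l01 b f : lyx_word [::] (rcons b 0%N) f =
  - (w23 k g * lyx_word [::] b (f \o cons false)
     + w23 k h * lyx_word [::] b (f \o cons true)).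
Proof.
rewrite lyx_word_step -?size_eq0 ?size_rcons ?orbT // /step /lyx_word.
by rewrite !map_rcons /lyx !V_l01 opprD.
Qed.

Lemma lyx_word_rcons a p b q f :
  let o (x : p5letter) (f' : seq bool -> k) :=
    (if p is p'.+1 then w45 k x * lyx_word (rcons a p') (rcons b q) f'
     else - (w34 k x * lyx_word a (rcons b q) f')
          - (w45 k x - w34 k x) * lyx_word (rcons a (head 0%N (rcons b q)))
                                          (behead (rcons b q)) f')
    + (if q is q'.+1 then w12 k x * lyx_word (rcons a p) (rcons b q') f'
       else - (w23 k x * lyx_word (rcons a p) b f')) in
  lyx_word (rcons a p) (rcons b q) f
  = o g (f \o cons false) + o h (f \o cons true).
Proof.
rewrite lyx_word_step -?size_eq0 ?size_rcons // /step /lyx_word !map_rcons /lyx.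
rewrite !V_peel ?all_succ //.
have -> : head 0%N (rcons [seq n.+1 | n <- b] q.+1) = (head 0%N (rcons b q)).+1.
  by case: (b).
have -> : behead (rcons [seq n.+1 | n <- b] q.+1)
    = [seq n.+1 | n <- behead (rcons b q)].
  by rewrite -map_rcons behead_map.
by case: p => [|p]; case: q => [|q]; rewrite ?map_rcons.
Qed.

End Bar.
Section Letters.
Variable k : fieldType.
Implicit Types (a b c : seq nat) (f : seq bool -> k).

Lemma omega_letter i j r : (0 < i <= 5)%N -> (0 < j <= 5)%N ->
  omega k r (strand i, strand j) = (nth 0 (p5_coord i j) r)%:~R.
Proof.
case: i j => [//|i] [//|j] /andP[_ i5] /andP[_ j5].
by rewrite /omega /strand /= !inordK.
Qed.

(** On x_12 and x_23 the forms w24, w45 and w34 vanish, so that no entry of a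
    is ever removed by the recursion. *)
Lemma lyx123_eq0 a b f : a != [::] ->
  lyx_word (strand 1, strand 2) (strand 2, strand 3) a b f = 0.
Proof.
set L := lyx_word _ _.
have w24g : w24 k (strand 1, strand 2) = 0 by rewrite /w24 omega_letter.
have w24h : w24 k (strand 2, strand 3) = 0 by rewrite /w24 omega_letter.
have w45g : w45 k (strand 1, strand 2) = 0 by rewrite /w45 omega_letter.
have w45h : w45 k (strand 2, strand 3) = 0 by rewrite /w45 omega_letter.
have w34g : w34 k (strand 1, strand 2) = 0 by rewrite /w34 omega_letter.
have w34h : w34 k (strand 2, strand 3) = 0 by rewrite /w34 omega_letter.
case/lastP: a => [//|a p] _; elim/last_ind: b f => [|b q IHb] f.
  elim: p f => [|p IH] f; first by rewrite /L lyx_word_r01 w24g w24h; ring.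
  by rewrite /L lyx_word_r0S -/L !IH; ring.
elim: q f => [|q IHq] f; rewrite /L lyx_word_rcons w45g w45h w34g w34h -/L;
  rewrite ?IHb ?IHq; case: (p) => [|p']; ring.
Qed.

Definition lyx451 a b f :=
  lyx_word (strand 4, strand 5) (strand 5, strand 1) a b f.

(* The values of the forms on x_51 come from x_51 = x_34 + x_24 + x_23. *)

Let w12g : w12 k (strand 4, strand 5) = 0.
Proof. by rewrite /w12 omega_letter. Qed.
Let w12h : w12 k (strand 5, strand 1) = 0.
Proof. by rewrite /w12 omega_letter. Qed.
Let w23g : w23 k (strand 4, strand 5) = 0.
Proof. by rewrite /w23 omega_letter. Qed.
Let w23h : w23 k (strand 5, strand 1) = 1.
Proof. by rewrite /w23 omega_letter. Qed.
Let w24g : w24 k (strand 4, strand 5) = 0.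
Proof. by rewrite /w24 omega_letter. Qed.
Let w24h : w24 k (strand 5, strand 1) = 1.
Proof. by rewrite /w24 omega_letter. Qed.
Let w34g : w34 k (strand 4, strand 5) = 0.
Proof. by rewrite /w34 omega_letter. Qed.
Let w34h : w34 k (strand 5, strand 1) = 1.
Proof. by rewrite /w34 omega_letter. Qed.
Let w45g : w45 k (strand 4, strand 5) = 1.
Proof. by rewrite /w45 omega_letter. Qed.
Let w45h : w45 k (strand 5, strand 1) = 0.
Proof. by rewrite /w45 omega_letter. Qed.

Lemma lyx451_nil a f : lyx451 a [::] f = li a f.
Proof.
elim/last_ind: a f => [|a p IH] f.
  by rewrite /lyx451 lyx_word_nil /li mul1r.
elim: p f => [|p IHp] f.
  by rewrite /lyx451 lyx_word_r01 w24g w24h mul0r add0r mul1r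
      -/(lyx451 _ _ _) IH li_rcons0.
rewrite /lyx451 lyx_word_r0S w45g w45h w12g w12h !addr0 mul1r mul0r addr0.
by rewrite -/(lyx451 _ _ _) IHp li_rconsS.
Qed.

Lemma lyx451_lS b q f : lyx451 [::] (rcons b q.+1) f = 0.
Proof. by rewrite /lyx451 lyx_word_l0S w12g w12h; ring. Qed.

Lemma lyx451_l0 b f :
  lyx451 [::] (rcons b 0%N) f = - lyx451 [::] b (f \o cons true).
Proof. by rewrite /lyx451 lyx_word_l01 w23g w23h; ring. Qed.

Lemma lyx451_rcons a p b q f :
  let b1 := head 0%N (rcons b q) in let b' := behead (rcons b q) in
  lyx451 (rcons a p) (rcons b q) f =
  (if p is p'.+1 then lyx451 (rcons a p') (rcons b q) (f \o cons false)
   else - lyx451 a (rcons b q) (f \o cons true)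
        - lyx451 (rcons a b1) b' (f \o cons false)
        + lyx451 (rcons a b1) b' (f \o cons true))
  - (if q is 0%N then lyx451 (rcons a p) b (f \o cons true) else 0).
Proof.
rewrite /lyx451 lyx_word_rcons w45g w45h w34g w34h w12g w12h w23g w23h.
by case: p => [|p]; case: q => [|q] /=; ring.
Qed.

Lemma lyx_psi a b (psi : ncps bool k) :
  all (leq 1) a -> all (leq 1) b -> a != [::] ->
  p5_eval (lyx a b) (psi_ijk psi 4 5 1 + psi_ijk psi 1 2 3)
  = lyx451 [seq n.-1 | n <- a] [seq n.-1 | n <- b] psi.
Proof.
move=> a0 b0 na.
have predK c : all (leq 1) c -> [seq n.+1 | n <- [seq n.-1 | n <- c]] = c.
  move=> /allP c0; rewrite -map_comp -[RHS]map_id; apply/eq_in_map => n /c0.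
  by case: n.
have bl : bounded_linear (lyx (k := k) a b) by apply: blin_bar.
have -> : psi_ijk psi 4 5 1 + psi_ijk psi 1 2 3 =
    (\pi_(Quotient.quot (p5_ideal k)) (ev2 psi (p5x k 4 5) (p5x k 5 1)
      + ev2 psi (p5x k 1 2) (p5x k 2 3)))%qT.
  by rewrite Quotient.pi_add.
rewrite lyx_eval // (blinD _ _ bl).
have E g h : lyx a b (ev2 psi (ncvar k g) (ncvar k h)) =
    lyx_word g h [seq n.-1 | n <- a] [seq n.-1 | n <- b] psi.
  rewrite /lyx_word !predK //; congr (lyx _ _ (ev2 _ _ _)).
by rewrite !E lyx123_eq0 ?addr0 //; case: (a) na.
Qed.

End Letters.
(** * The product of two polylogarithms *)

(** The stuffle of a and b prefixed by c, where a word that exhausts a first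
    contributes its coefficient, and a word that exhausts b first, leaving the
    tail a'' of a after c'', contributes lyx451 c'' a''. For c empty this is
    Li_a(x) Li_b(y), expanded into a sum of polylogarithms and restricted to
    psi_451. *)
Fixpoint mixed (k : fieldType) (a : seq nat) :
    seq nat -> seq nat -> (seq bool -> k) -> k :=
  if a is a1 :: a' then
    fix mixed_a b c f := if b is b1 :: b' then
        mixed a' b (rcons c a1) f + mixed_a b' (rcons c b1) f
        + mixed a' b' (rcons c (a1 + b1).+1) f
      else lyx451 c a f
  else fun b c f => li (c ++ b) f.
Arguments mixed : simpl never.

Section Mixed.
Variable k : fieldType.
Implicit Types (a b c : seq nat) (f : seq bool -> k).

Lemma mixed_nill b c f : mixed [::] b c f = li (c ++ b) f. Proof. by []. Qed.

Lemma mixed_nilr a c f : mixed a [::] c f = lyx451 c a f.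
Proof. by case: a => //; rewrite mixed_nill cats0 lyx451_nil. Qed.

Lemma mixed_cons (a1 b1 : nat) a b c f : mixed (a1 :: a) (b1 :: b) c f =
  mixed a (b1 :: b) (rcons c a1) f + mixed (a1 :: a) b (rcons c b1) f
  + mixed a b (rcons c (a1 + b1).+1) f.
Proof. by []. Qed.

(** The differential equations of the product Li_a(x) Li_b(y). The extra terms
    in the recursion of [lyx451], which move an entry across, cancel between
    neighbouring words of the stuffle. *)
Lemma mixed_rcons a p b q c f : mixed (rcons a p) (rcons b q) c f =
  (if q is q'.+1 then mixed (rcons a p) (rcons b q') c (f \o cons false)
   else - mixed (rcons a p) b c (f \o cons true))
  - (if p is 0%N then mixed a (rcons b q) c (f \o cons true) else 0).
Proof.
elim: a b c f => [|a1 a IHa] b c f.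
  elim: b c f => [|b1 b IHb] c f.
    rewrite [mixed _ _ _ _]mixed_cons !mixed_nill mixed_nilr cats0 cats1.
    rewrite -[[:: p]]/(rcons [::] p) lyx451_rcons /= !lyx451_nil.
    case: q => [|q].
      rewrite addn0 li_rcons0 li_rconsS mixed_nilr.
      by case: p => [|p]; rewrite ?mixed_nill ?cats1 ?lyx451_nil; ring.
    rewrite addnS [li (rcons c (p + q).+2) f]li_rconsS li_rconsS.
    rewrite mixed_cons !mixed_nill mixed_nilr cats0 !cats1.
    by case: p => [|p]; rewrite ?mixed_nill ?cats1; ring.
  rewrite !rcons_cons mixed_cons !mixed_nill -!rcons_cons IHb -!rcons_cat.
  case: q {IHb} => [|q].
    rewrite !li_rcons0 mixed_cons !mixed_nill.
    by case: p => [|p]; rewrite ?mixed_nill -?rcons_cat ?li_rcons0 ?li_rconsS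
      ?cat_rcons /=; ring.
  rewrite !li_rconsS rcons_cons mixed_cons !mixed_nill -!rcons_cons -!rcons_cat.
  by case: p => [|p]; rewrite ?mixed_nill -?rcons_cat ?li_rcons0 ?li_rconsS
      ?cat_rcons /=; ring.
elim: b c f => [|b1 b IHb] c f.
  have IHa0 c' f' : mixed (rcons a p) [:: q] c' f' = _ := IHa [::] c' f'.
  rewrite rcons_cons mixed_cons IHa0 !mixed_nilr -!rcons_cons !lyx451_rcons /=.
  case: q {IHa IHa0} => [|q].
    rewrite ?mixed_nilr addn0.
    by case: p => [|p]; rewrite ?mixed_cons ?mixed_nilr ?addn0; ring.
  rewrite mixed_cons !mixed_nilr.
  case: p => [|p]; rewrite ?mixed_cons ?mixed_nilr !addnS ?lyx451_rcons; ring.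
rewrite !rcons_cons mixed_cons -!rcons_cons IHb !IHa !rcons_cons.
have E s d : mixed (a1 :: rcons a p) (b1 :: s) d =
    fun f' => mixed (rcons a p) (b1 :: s) (rcons d a1) f'
      + mixed (a1 :: rcons a p) s (rcons d b1) f'
      + mixed (rcons a p) s (rcons d (a1 + b1).+1) f' by [].
case: q {IHa IHb} => [|q]; rewrite E; case: p {E} => [|p];
  rewrite ?rcons_cons ?[mixed (a1 :: a) _ c _]mixed_cons; ring.
Qed.



(** Solving these equations: Li_a(x) restricts to a multiple of the coefficient
    of x1^k if a is all ones and to zero otherwise, and Li_b(y) to [li b]; the
    product of functionals is the shuffle product of words. *)
Lemma mixed_shuf a b f : mixed a b [::] f =
  if all (pred1 0%N) a then
    (-1) ^+ (size a + size b) * shuf (nseq (size a) true) (index_word b) f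
  else 0.
Proof.
elim/last_ind: a b f => [|a p IHa] b f; first by [].
rewrite all_rcons size_rcons; elim/last_ind: b f => [|b q IHb] f.
  have IH f' : lyx451 [::] a f' = _ :=
    etrans (esym (mixed_nilr a [::] f')) (IHa [::] f').
  rewrite mixed_nilr; case: p => [|p]; last by rewrite lyx451_lS.
  rewrite lyx451_l0 IH /=; case: ifP => _; last by rewrite oppr0.
  by rewrite !shuf0 !addn0 exprS /=; ring.
elim: q f => [|q IHq] f;
  rewrite mixed_rcons ?IHq ?IHb IHa !index_word_rcons !size_rcons.
  case: p {IHb} => [|p] /=; last by rewrite subr0 oppr0.
  case: ifP => _; last by rewrite subr0 oppr0.
  rewrite shuf_cons !addSn !addnS !exprS; ring.
case: p {IHb IHq} => [|p] /=; last by rewrite subr0.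
case: ifP => _; last by rewrite subr0.
rewrite shuf_cons !addSn !addnS !exprS; ring.
Qed.

Lemma index_word_eq0 a : (index_word a == [::]) = (a == [::]).
Proof.
case/lastP: a => [//|a p].
by rewrite index_word_rcons -!size_eq0 size_cat size_rcons addnS.
Qed.

Variable psi : ncps bool k.
Hypothesis lie_psi : lie_series psi.

Lemma mixed_lie a b : a != [::] -> b != [::] -> mixed a b [::] psi = 0.
Proof.
move=> a0 b0; rewrite mixed_shuf; case: ifP => // _.
by rewrite shuf_lie ?mulr0 ?index_word_eq0 // -size_eq0 size_nseq size_eq0.
Qed.

Definition lyx_is_li c a := lyx451 c a psi = li (c ++ a) psi.

Lemma mixed_stuf a b c : (c != [::]) || (b != [::]) ->
  (0 < sumn c + sumn a + sumn b)%N ->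
  (forall c' a' : seq nat, c' != [::] -> a' != [::] -> (size a' <= size a)%N ->
     (0 < sumn c' + sumn a')%N -> lyx_is_li c' a') ->
  mixed a b c psi = stuf a b (fun w => li (c ++ w) psi).
Proof.
elim: a b c => [//|a1 a IHa] b c.
elim: b c => [|b1 b IHb] c.
  by rewrite orbF addn0 mixed_nilr stuf0 => c0 s0; apply.
have rc (d : nat) : rcons c d != [::] by rewrite -size_eq0 size_rcons.
move=> cb s0 H; rewrite mixed_cons stuf_cons IHb ?rc //; last first.
  by move: s0; rewrite /= sumn_rcons; lia.
rewrite !IHa ?rc //; try by move: s0; rewrite /= ?sumn_rcons; lia.
- by congr (_ + _ + _); congr (stuf _ _ _);
    apply/funext => w /=; rewrite cat_rcons.
- by move=> c' a' c0 a0 sa; apply: H => //; apply: leq_trans sa _.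
- by move=> c' a' c0 a0 sa; apply: H => //; apply: leq_trans sa _.
Qed.

(** Only the word b ++ a of the stuffle leaves all of a as its tail. *)
Lemma mixed_stuf_last a b c : a != [::] -> (c != [::]) || (b != [::]) ->
  (0 < sumn c + sumn a + sumn b)%N ->
  (forall c' a' : seq nat, c' != [::] -> a' != [::] -> (size a' < size a)%N ->
     (0 < sumn c' + sumn a')%N -> lyx_is_li c' a') ->
  mixed a b c psi = stuf a b (fun w => li (c ++ w) psi)
    + (lyx451 (c ++ b) a psi - li (c ++ b ++ a) psi).
Proof.
case: a => [//|a1 a] _ cb s0 H; elim: b c cb s0 => [|b1 b IHb] c cb s0.
  by rewrite mixed_nilr stuf0 /= cats0 addrC subrK.
have rc (d : nat) : rcons c d != [::] by rewrite -size_eq0 size_rcons.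
rewrite mixed_cons stuf_cons IHb ?rc //; last first.
  by move: s0; rewrite /= sumn_rcons; lia.
rewrite !mixed_stuf ?rc //; try by move: s0; rewrite /= ?sumn_rcons; lia.
have E d v v' : stuf v v' (fun w => li (rcons c d ++ w) psi)
    = stuf v v' ((fun w => li (c ++ w) psi) \o cons d).
  by congr (stuf _ _ _); apply/funext => w /=; rewrite cat_rcons.
by rewrite !E !cat_rcons; ring.
Qed.

(** The relation of [mixed_stuf_last] is triangular with respect to the length
    of the tail a, so it can be inverted. *)
Lemma stuffle_lyx_is_li :
  (forall a b, a != [::] -> b != [::] -> (0 < sumn a + sumn b)%N ->
     stuf a b (fun w => li w psi) = 0) <->
  (forall c a, c != [::] -> a != [::] -> (0 < sumn c + sumn a)%N ->
     lyx_is_li c a).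
Proof.
split=> H; last first.
  move=> a b a0 b0 s0; rewrite -[RHS](mixed_lie a0 b0) mixed_stuf ?b0 //.
  by move=> c' a' c0 a'0 _; apply: H.
move=> c a; move En : (size a) => n.
elim/ltn_ind: n a c En => n IH a c En c0 a0 s0.
have := mixed_lie a0 c0; rewrite mixed_stuf_last ?c0 ?orbT //.
- rewrite H //; last by rewrite addnC.
  by move/eqP; rewrite add0r subr_eq0 => /eqP.
- by rewrite addnC.
- by move=> c' a' c'0 a'0 sa; apply: (IH (size a')); rewrite -?En.
Qed.

End Mixed.
(** * Second index of depth one *)

Section Gap.
Variable k : fieldType.
Implicit Types (a b c : seq nat) (w v : seq bool) (f g : seq bool -> k).

Definition block n v : seq bool := nseq n false ++ true :: v.

Lemma index_word_block a n : index_word (rcons a n) = block n (index_word a).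
Proof. exact: index_word_rcons. Qed.

(** The sum of f(p (x0 - x1) x0^n x1 q) over the decompositions w = p x1 q. *)
Fixpoint ins n f w : k :=
  if w is x :: v then
    (if x then f (false :: block n v) - f (true :: block n v) else 0)
    + ins n (f \o cons x) v
  else 0.

Definition gap n f w : k := ins n f w - f (block n w).

Fixpoint doubling f w : k :=
  if w is x :: v then f (x :: x :: v) + doubling (f \o cons x) v else 0.

Lemma insD n f g w : ins n (fun v => f v + g v) w = ins n f w + ins n g w.
Proof.
elim: w f g => [|x v IH] f g; first by rewrite addr0.
rewrite /= (IH (f \o cons x) (g \o cons x)); case: x; ring.
Qed.

Lemma ins_eq0 n f w : (forall v, v != [::] -> f v = 0) -> ins n f w = 0.
Proof.
elim: w f => [//|x v IH] f f0; rewrite /= IH ?addr0 => [|u _]; last exact: f0.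
by case: x; rewrite // !f0 ?subrr.
Qed.

Lemma shuf_block n v f : shuf [:: false] (block n v) f =
  n.+1%:R * f (block n.+1 v) + shuf [:: false] v (f \o block n).
Proof.
elim: n f => [|n IH] f; rewrite /block /= shuf1_cons; first by rewrite mul1r.
by rewrite IH [n.+2%:R]mulrS mulrDl mul1r addrA.
Qed.

(** An x0 inserted in p or q gives a term of the first sum on the right; the n
    + 1 places inside the block x0^n x1 all give the block x0^(n+1) x1. *)
Lemma shuf_ins n f w : shuf [:: false] w (ins n f) =
  ins n (fun v => shuf [:: false] v f) w - n.+1%:R * ins n.+1 f w.
Proof.
elim: w f => [|x v IH] f; first by rewrite shuf0 /= mulr0 addr0 subr0.
rewrite shuf1_cons [ins n f \o cons x](_ : _ = fun u =>
    (if x then f (false :: block n u) - f (true :: block n u) else 0)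
    + ins n (f \o cons x) u) // shufD IH.
rewrite [RHS]/= -[(fun u => shuf [:: false] u f) \o cons x]/(fun u =>
  (f \o cons false \o cons x) u + shuf [:: false] u (f \o cons x)) insD.
case: x; last by rewrite shufC0 /=; ring.
rewrite -[X in shuf [:: false] v X]/(fun u =>
   (f \o cons false \o block n) u + - (f \o cons true \o block n) u).
have -> : (fun u => (f \o cons false \o block n) u
                    + - (f \o cons true \o block n) u) =
    fun u => -1 * (f \o cons true \o block n) u
             + (f \o cons false \o block n) u.
  by apply/funext => u; rewrite mulN1r addrC.
rewrite shuf_lin !shuf1_cons !shuf_block /=; ring.
Qed.

Lemma shuf_gap n f w : (forall v, v != [::] -> shuf [:: false] v f = 0) ->
  shuf [:: false] w (gap n f) = - (n.+1%:R * gap n.+1 f w).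
Proof.
move=> H; rewrite /gap.
have -> : (fun v => ins n f v - f (block n v)) =
    (fun v => -1 * (f \o block n) v + ins n f v).
  by apply/funext => v; rewrite mulN1r addrC.
rewrite shuf_lin shuf_ins ins_eq0 //.
have := shuf_block n w f; rewrite H => [/esym/eqP|]; last by case: (n).
rewrite addrC addr_eq0 => /eqP->; ring.
Qed.

(** Inserting x0 before a letter x0 doubles it, while inserting it before a
    letter x1 differs from doubling that x1 by a term of [ins 0 f]. *)
Lemma shuf_doubling f w :
  shuf [:: false] w f = doubling f w + ins 0 f w + f (rcons w false).
Proof.
elim: w f => [|x v IH] f; first by rewrite shuf0 !add0r.
rewrite shuf1_cons IH /= /block; case: x => /=; ring.
Qed.

Lemma doubling_nseq f x n : doubling f (nseq n x) = n%:R * f (nseq n.+1 x).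
Proof.
elim: n f => [|n IH] f; first by rewrite mul0r.
by rewrite /= IH [n.+1%:R]mulrS mulrDl mul1r.
Qed.

(** The shuffle with x1 comes from the rule for a last entry 1 of the second
    index, which emits an x1 at every position; it kills Lie series. *)
Lemma lyx451_single a n f : lyx451 a [:: n] f = - (-1) ^+ size a *
  (ins n f (index_word a)
   + if n is 0%N then shuf [:: true] (index_word a) f else 0).
Proof.
elim/last_ind: a f => [|a p IH] f.
  rewrite -[[:: n]]/(rcons [::] n); case: n => [|n].
    by rewrite lyx451_l0 lyx451_nil /li shuf0 /=; ring.
  by rewrite lyx451_lS /=; ring.
rewrite size_rcons index_word_block; elim: p f => [|p IHp] f.
  rewrite -[[:: n]]/(rcons [::] n) lyx451_rcons /= IH !lyx451_nil /li.
  rewrite index_word_block !size_rcons exprS.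
  case: n {IH} => [|n];
  rewrite ?index_word_block ?shuf1_cons /= /block /=; ring.
rewrite -[[:: n]]/(rcons [::] n) lyx451_rcons /= IHp !lyx451_nil /li.
rewrite index_word_block !size_rcons exprS.
case: n {IH IHp} => [|n];
  rewrite ?index_word_block ?shuf1_cons /= /block /=; ring.
Qed.

Lemma mem_false_index a : (false \in index_word a) = (0 < sumn a)%N.
Proof.
elim/last_ind: a => [//|a p IH].
rewrite index_word_block mem_cat mem_nseq inE IH sumn_rcons andbT.
by rewrite addnC addn_gt0.
Qed.

Lemma mem_true_index a : (true \in index_word a) = (a != [::]).
Proof.
case/lastP: a => [//|a p].
by rewrite index_word_block mem_cat inE eqxx orbT -size_eq0 size_rcons.
Qed.

Lemma word_index w : exists a m, w = index_word a ++ nseq m false.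
Proof.
elim: w => [|x w [a [m ->]]]; first by exists [::], 0%N.
case: x; first by exists (rcons a 0%N), m; rewrite index_word_block.
case/lastP: a => [|a p]; first by exists [::], m.+1.
by exists (rcons a p.+1), m; rewrite !index_word_block.
Qed.

(** The usual elimination of trailing letters x0: f is assumed to vanish at the
    words obtained by inserting x0 before the last x1. *)
Lemma shuf_index a m f :
    (forall a', size a' = size a -> sumn a' = (sumn a).+1 ->
       f (index_word a' ++ nseq m false) = 0) ->
  shuf [:: false] (index_word a ++ nseq m false) f =
  m.+1%:R * f (index_word a ++ nseq m.+1 false).
Proof.
elim/last_ind: a f => [|a p IH] f H; first exact: shuf1_nseq.
have blockC n u v : block n u ++ v = block n (u ++ v) by rewrite /block -catA.
rewrite !index_word_block !blockC shuf_block -blockC -index_word_block H.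
- rewrite mulr0 add0r IH // => a' sz sm /=.
  rewrite -blockC -index_word_block H ?size_rcons ?sz //.
  by rewrite !sumn_rcons sm.
- by rewrite !size_rcons.
- by rewrite !sumn_rcons addnS.
Qed.

End Gap.
(** * The reduced coaction equation *)

Section ReducedCoaction.
Variable k : fieldType.
Implicit Types (x y z : bool) (u v w : seq bool).

Lemma ncword_cons x u : ncword k (x :: u) = ncvar k x * ncword k u.
Proof.
apply/ncpsP => -[|y w]; first by rewrite ncvarM_nil.
rewrite ncvarM_cons !ncwordE eqseq_cons.
by case: (y == x); rewrite ?mul1r ?mul0r.
Qed.

Lemma ncvarX x n : ncvar k x ^+ n = ncword k (nseq n x).
Proof. by elim: n => [//|n IH]; rewrite exprS IH ncword_cons. Qed.

Lemma mu_word_nil u : mu_word k u [::] = 0.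
Proof.
rewrite /mu_word; elim/big_ind: _ => // [f g f0 g0|i _].
  by rewrite ncDE f0 g0 addr0.
by rewrite !ncM_nil /odot; case: ifP; rewrite ?mulr0 mul0r.
Qed.

Lemma mu_word_cons x u z w : mu_word k (x :: u) (z :: w) =
  (z == x)%:R * ((u == x :: w)%:R + mu_word k u w).
Proof.
case: u => [|y u].
  by rewrite /mu_word /= !big_ord0 add0r mulr0.
have -> : mu_word k [:: x, y & u] =
    odot k x y * ncword k u + ncvar k x * mu_word k (y :: u).
  rewrite /mu_word [LHS]big_ord_recl take0 [ncword k [::] * _]mul1r /= drop0.
  rewrite mulr_sumr; congr (_ + _); apply: eq_bigr => i _.
  by rewrite -!mulrA ncword_cons -!mulrA.
rewrite ncDE ncvarM_cons mulrDr; congr (_ + _).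
rewrite eqseq_cons /odot [y == x]eq_sym; case: (eqVneq x y) => [_|_].
  by rewrite ncvarM_cons ncwordE [w == u]eq_sym.
by rewrite mul0r mulr0.
Qed.

Lemma sum_words_pick (X : finType) M (G : seq X -> k) (v : seq X) :
    (size v < M)%N ->
  \sum_(m < M) \sum_(w : m.-tuple X) G w * (tval w == v)%:R = G v.
Proof.
elim: v M G => [|y v IH] [//|M] G sM;
  rewrite (sum_words_cons M (fun w : seq X => G w * (w == _)%:R)).
  rewrite mulr1 big1 ?addr0 // => x _; rewrite big1 // => m _.
  by rewrite big1 // => w _; rewrite mulr0.
rewrite mulr0 add0r (bigD1 y) //= -[RHS](IH M (G \o cons y)) //.
rewrite [X in _ + X]big1 ?addr0 => [|x xy].
  by apply: eq_bigr => m _; apply: eq_bigr => w _; rewrite eqseq_cons eqxx.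
rewrite big1 // => m _; rewrite big1 // => w _.
by rewrite eqseq_cons (negbTE xy) mulr0.
Qed.

Lemma mu_doubling (f : ncps bool k) w : mu f w = doubling f w.
Proof.
have -> : mu f w =
    \sum_(n < (size w).+2) \sum_(u : n.-tuple bool) f u * mu_word k u w.
  by rewrite /mu /ncext /= addn1.
elim: w (ncoef f) => [|z w IH] {}f.
  by rewrite big1 // => m _; rewrite big1 // => u _; rewrite mu_word_nil mulr0.
rewrite (sum_words_cons _ (fun u => f u * mu_word k u (z :: w))).
have -> : mu_word k [::] = 0 by apply: big_ord0.
rewrite mulr0 add0r (bigD1 z) //=.
rewrite [X in _ + X]big1 ?addr0 => [|x xz]; last first.
  rewrite big1 // => m _; rewrite big1 // => u _.
  by rewrite mu_word_cons eq_sym (negbTE xz) mul0r mulr0.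
rewrite -(IH (f \o cons z)) -[f [:: z, z & w]]/((f \o cons z) (z :: w)).
rewrite -(@sum_words_pick _ (size (z :: w)).+1 (f \o cons z) (z :: w)) //.
rewrite -big_split.
apply: eq_bigr => m _; rewrite -big_split; apply: eq_bigr => u _.
by rewrite mu_word_cons eqxx mul1r mulrDr.
Qed.

Lemma r_ser_var (psi : ncps bool k) x c w : r_ser psi (c *: ncvar k x) w =
  if (0 < size w)%N && (w == nseq (size w) x)
  then c ^+ size w * psi (zword (size w).+1) else 0.
Proof.
have E l : (c *: ncvar k x : ncps bool k) ^+ l.+1
    = c ^+ l.+1 *: ncword k (nseq l.+1 x).
  by rewrite exprZn ncvarX.
rewrite /r_ser [LHS]/=; case sw : (size w) => [|n]; first by rewrite big_ord0.
rewrite big_ord_recr big1 => [|l _] /=.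
  rewrite add0r E ncZE ncwordE.
  by case: eqP => _; rewrite ?mulr1 ?mulr0 // mulrC.
rewrite E ncZE ncwordE; case: eqP => [wl|_]; last by rewrite !mulr0.
by have := ltn_ord l; rewrite -ltnS -sw wl size_nseq ltnn.
Qed.

End ReducedCoaction.

Section SkewSeries.
Variable k : fieldType.
Hypothesis char0 : [pchar k] =i pred0.
Variable psi : ncps bool k.
Hypothesis skew_psi : Skew psi.
Implicit Types (w : seq bool) (a c : seq nat).

Lemma skew_lie : lie_series psi. Proof. by case: skew_psi => -[]. Qed.

Lemma skew_shuf1 x v : v != [::] -> shuf [:: x] v psi = 0.
Proof. by move=> v0; rewrite shuf_lie //; apply: skew_lie. Qed.

Lemma skew_negb w : psi (map negb w) = - psi w.
Proof.
have ev_negb (f : ncps bool k) : ev2 f (X1 k) (X0 k) w = f (map negb w).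
  elim: w f => [|x v IH] f; first exact: ev2_nil.
  by rewrite ev2_cons !IH /=; case: x; rewrite /= ?mul0r ?mul1r ?addr0 ?add0r.
by case: skew_psi => _ {2}->; rewrite ncNE opprK ev_negb.
Qed.

Lemma skew_letter x : psi [:: x] = 0.
Proof.
have : psi [:: false] = 0 /\ psi [:: true] = 0.
  case: skew_psi => -[_ /ncpsP/(_ [:: false]) H0 /ncpsP/(_ [:: true]) H1] _.
  move: H0 H1; rewrite /ev2 /ncsubst /ncext /=.
  have E (s : bool -> ncps bool k) y :
      \sum_(n < 2) \sum_(u : n.-tuple bool)
         psi u * (\prod_(x <- u) s x) [:: y] =
      psi [:: true] * s true [:: y] + psi [:: false] * s false [:: y].
    pose G u := psi u * (\prod_(x <- u) s x) [:: y].
    rewrite (sum_words_cons 1 G) /G big_nil mulr0 add0r big_bool.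
    rewrite (sum_words_cons 0 (G \o cons true)).
    rewrite (sum_words_cons 0 (G \o cons false)) /G /=.
    rewrite !big_cons !big_nil !mulr1 !big1 ?addr0 // => i _; exact: big_ord0.
  by rewrite !E /= !mulr0 !mulr1 add0r addr0.
by case: x => -[].
Qed.

Lemma skew_nseq x n : psi (nseq n.+1 x) = 0.
Proof.
case: n => [|n]; first exact: skew_letter.
have /eqP := skew_shuf1 x (v := nseq n.+1 x) isT.
by rewrite shuf1_nseq mulf_eq0 (negbTE (natr_neq0 char0 _)) => /eqP.
Qed.

(** Reversal of the word x1 x0^n, through the shuffles of x0^i x1 x0^j with x0:
    the coefficients at x0^i x1 x0^j, multiplied by i! j!, alternate in sign
    along i + j = n. *)
Lemma skew_reverse n :
  psi (true :: nseq n false) = (-1) ^+ n * psi (zword n.+1).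
Proof.
have zwordE : zword n.+1 = block n [::] by rewrite /zword /block /= cats1.
pose e i j := i`!%:R * j`!%:R * psi (block i (nseq j false)).
have eS i j : e i j.+1 = - e i.+1 j.
  have b0 : block i (nseq j false) != [::] by case: (i).
  have /eqP := skew_shuf1 false b0.
  rewrite shuf_block shuf1_nseq addrC addr_eq0 /e !factS !natrM => /eqP H.
  have -> : i`!%:R * (j.+1%:R * j`!%:R) * psi (block i (nseq j.+1 false))
     = i`!%:R * j`!%:R * (j.+1%:R * psi (block i (nseq j.+1 false))) :> k.
    by ring.
  by rewrite H /=; ring.
have e0 j i : e i j = (-1) ^+ j * e (i + j)%N 0%N.
  elim: j i => [|j IH] i; first by rewrite mul1r addn0.
  by rewrite eS IH exprS addSnnS; ring.
have := e0 n 0%N; rewrite /e add0n fact0 !mul1r mulr1 mulrCA zwordE.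
apply: mulfI; rewrite -(prednK (fact_gt0 n)); exact: natr_neq0.
Qed.

(** The terms of r_psi only affect the powers of a letter, at which the equation
    holds for every skew Lie series. *)
Lemma rc_eq_gap : rc_eq psi <->
  forall w, true \in w -> false \in w -> gap 0 psi w = 0.
Proof.
have key w : w != [::] -> mu psi w =
    - gap 0 psi w - psi (rcons w false) - psi (true :: w).
  move=> w0; have := skew_shuf1 false w0.
  rewrite shuf_doubling mu_doubling /gap.
  move/eqP; rewrite -addrA addr_eq0 => /eqP->; rewrite /block /=; ring.
have rhs w : (- r_ser psi (X1 k) + r_ser psi (- X0 k)
      - dL false psi - dR true psi) w =
    - r_ser psi (1 *: X1 k) w + r_ser psi (-1 *: X0 k) w
      - psi (rcons w false) - psi (true :: w).
  by rewrite scale1r scaleN1r.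
have nz w x : true \in w -> false \in w -> (w == nseq (size w) x) = false.
  move=> tw fw; apply/negP => /eqP E; move: tw fw; rewrite E !mem_nseq.
  by case: (x); rewrite ?andbF.
split=> [/ncpsP H w tw fw|H].
  have w0 : w != [::] by case: (w) tw.
  have := H w; rewrite key // rhs !r_ser_var !nz // !andbF oppr0 addr0.
  by move=> /addIr/addIr/eqP; rewrite oppr_eq0 => /eqP.
apply/ncpsP => w; rewrite rhs !r_ser_var; case: (eqVneq w [::]) => [->|w0].
  by rewrite mu_doubling /= !skew_letter; ring.
have sw : (0 < size w)%N by case: (w) w0.
rewrite sw !andTb.
have [tw|tw] := boolP (true \in w); have [fw|fw] := boolP (false \in w).
- by rewrite !nz // key // H // oppr0 addr0.
- have E : w = nseq (size w) true.
    by apply/all_pred1P/allP => -[] //; rewrite (negbTE fw).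
  rewrite mu_doubling E; case: (size w) sw => [//|m] _.
  rewrite doubling_nseq !skew_nseq size_nseq eqxx.
  rewrite (_ : (nseq _ _ == _) = false) //.
  have -> : rcons (nseq m.+1 true) false = map negb (zword m.+2).
    by rewrite /zword map_rcons map_nseq.
  rewrite skew_negb expr1n; ring.
- have E : w = nseq (size w) false.
    by apply/all_pred1P/allP => -[] //; rewrite (negbTE tw).
  rewrite mu_doubling E; case: (size w) sw => [//|m] _.
  rewrite doubling_nseq !skew_nseq size_nseq eqxx.
  rewrite (_ : (nseq _ _ == _) = false) //.
  have -> : rcons (nseq m.+1 false) false = nseq m.+2 false.
    by elim: (m.+1) => //= i ->.
  rewrite skew_reverse skew_nseq; ring.
- by case: (w) w0 tw fw => [|[]].
Qed.

End SkewSeries.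
(** * The equivalence *)

Section Equivalence.
Variable k : fieldType.
Hypothesis char0 : [pchar k] =i pred0.
Variable psi : ncps bool k.
Hypothesis lie_psi : lie_series psi.
Implicit Types (a c : seq nat).

Let shuf1_psi x v : v != [::] -> shuf [:: x] v psi = 0.
Proof. by move=> v0; rewrite shuf_lie. Qed.

Lemma gapS n w :
  gap n.+1 psi w = - (n.+1%:R^-1 * shuf [:: false] w (gap n psi)).
Proof.
rewrite shuf_gap => [|v]; last exact: shuf1_psi.
by rewrite mulrN opprK mulKf ?natr_neq0.
Qed.

Lemma lyx_is_li_gap a n : a != [::] ->
  lyx_is_li psi a [:: n] <-> gap n psi (index_word a) = 0.
Proof.
move=> a0; rewrite /lyx_is_li lyx451_single /li cats1.
rewrite size_rcons index_word_block.
rewrite (_ : (if n is 0%N then _ else 0) = 0); last first.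
  by case: n => // ; rewrite shuf1_psi // index_word_eq0.
rewrite addr0 exprS mulN1r /gap; split=> [|/eqP].
  by move/mulfI => ->; rewrite ?subrr // oppr_eq0 signr_eq0.
by rewrite subr_eq0 => /eqP->.
Qed.

(** From left to right, [gapS] expresses the gaps of depth n through gaps of
    depth zero on words with n more letters x0. From right to left, it removes
    the trailing letters x0 of a word, at the cost of increasing n. *)
Lemma gap_words :
  (forall w, true \in w -> false \in w -> gap 0 psi w = 0) <->
  (forall a n, a != [::] -> (0 < sumn a + n)%N -> gap n psi (index_word a) = 0).
Proof.
split=> H.
  have G n w : true \in w -> (0 < n)%N || (false \in w) -> gap n psi w = 0.
    elim: n w => [|n IH] w tw fw; first exact: H.
    rewrite gapS shuf1_eq0 ?mulr0 ?oppr0 // => u v E; apply: IH.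
      by move: tw; rewrite -E !mem_cat inE => /orP[]->; rewrite ?orbT.
    by rewrite mem_cat inE eqxx !orbT.
  move=> a n a0 an; apply: G; first by rewrite mem_true_index.
  by rewrite mem_false_index orbC -addn_gt0.
have G m a n : a != [::] -> (0 < sumn a + n + m)%N ->
    gap n psi (index_word a ++ nseq m false) = 0.
  elim: m a n => [|m IH] a n a0 s0.
    by rewrite cats0 H // -[X in (0 < X)%N]addn0.
  have := gapS n (index_word a ++ nseq m false).
  rewrite IH ?addnS // shuf_index => [/eqP|a' sz sm]; last first.
    by rewrite IH // -?size_eq0 ?sz ?size_eq0 // sm.
  rewrite eq_sym oppr_eq0 !mulf_eq0 invr_eq0 !(negbTE (natr_neq0 char0 _)).
  by move/eqP.
move=> w tw fw; have [a [m E]] := word_index w; rewrite E G //.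
  by move: tw; rewrite E mem_cat mem_true_index mem_nseq andbF orbF.
by move: fw; rewrite E mem_cat mem_false_index mem_nseq addn0 addn_gt0 andbT.
Qed.

Lemma piY_li v : piY psi v = li (rev v) psi.
Proof. by rewrite /li /index_word revK size_rev. Qed.

Lemma psi_star_li v : (0 < sumn v)%N -> psi_star psi v = li (rev v) psi.
Proof.
move=> v0; rewrite /psi_star ncDE -piY_li /=.
case: eqP => [E|_]; last by rewrite andbF add0r.
by move: v0; rewrite E sumn_nseq mul0n.
Qed.

(** The coproduct condition says that [psi_star psi] satisfies the stuffle
    relations; those between all-ones indices, the only ones in which psi_corr
    occurs, follow from the others. *)
Lemma dmr0_stuf : (forall x n, psi (nseq n.+1 x) = 0) ->
  dmr0 psi <-> psi [:: false; true] = 0 /\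
  forall a b : seq nat, a != [::] -> b != [::] -> (0 < sumn a + sumn b)%N ->
     stuf a b (fun w => li w psi) = 0.
Proof.
move=> psi_nseq.
have rev0 a : (rev a != [::]) = (a != [::]) by rewrite -!size_eq0 size_rev.
have star_li (u v : seq nat) : (0 < sumn u + sumn v)%N ->
    stuf u v (psi_star psi) = stuf (rev u) (rev v) (fun w => li w psi).
  move=> s0; rewrite stuf_rev; apply: stuf_ext => w sw _.
  by rewrite psi_star_li // (leq_trans s0).
split=> [[_ [_ _ ?] H]|[c01 H]].
  split=> // a b a0 b0 s0; have := H (rev a) (rev b).
  rewrite delta_starE star_li ?sumn_rev // !revK /tens !nc1E.
  rewrite (negbTE (_ : rev a != _)) ?rev0 // (negbTE (_ : rev b != _)) ?rev0 //.
  by rewrite mul0r mulr0 addr0.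
split=> [//||u v]; first by split=> //; apply: (psi_nseq _ 0%N).
have star0 : psi_star psi [::] = 0.
  by rewrite /psi_star ncDE piY_li /li /= add0r mul1r lie_nil.
rewrite delta_starE /tens !nc1E.
case: (eqVneq u [::]) => [->|u0].
  by rewrite stuf_nil star0 mul0r addr0 mul1r.
case: (eqVneq v [::]) => [->|v0].
  by rewrite stuf0 star0 mulr0 mulr1 add0r.
rewrite mul0r mulr0 addr0; apply: (stuf_all char0) => // [u' v' u'0 v'0 s0|m].
  by rewrite star_li // H ?rev0 ?sumn_rev.
have flat n : flatten [seq zword i.+1 | i <- nseq n 0%N] = nseq n true.
  by elim: n => //= n ->.
have -> : psi_star psi (nseq m.+2 0%N)
    = (-1) ^+ m.+2 / m.+2%:R * psi (zword m.+2).
  pose W := flatten [seq zword i.+1 | i <- nseq m.+2 0%N].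
  rewrite ncDE -[piY psi _]/(_ * psi W) /W.
  by rewrite flat psi_nseq mulr0 addr0 /= size_nseq eqxx.
rewrite psi_star_li // -[rev _]/(rcons [::] m.+1) /li index_word_block.
rewrite /block cats1 expr1 [_ / _]mulrC -mulrA mulVKf ?(natr_neq0 char0) //.
rewrite exprS; ring.
Qed.

End Equivalence.

Section DepthReduction.
Variable k : fieldType.
Variable psi : ncps bool k.

Lemma lyx_succ (c a : seq nat) : c != [::] ->
  p5_eval (lyx [seq n.+1 | n <- c] [seq n.+1 | n <- a])
    (psi_ijk psi 4 5 1 + psi_ijk psi 1 2 3) = lyx451 c a psi.
Proof.
have succK (s : seq nat) : [seq n.-1 | n <- [seq n.+1 | n <- s]] = s.
  by rewrite -map_comp map_id.
by move=> c0; rewrite lyx_psi ?all_succ ?succK //; case: (c) c0.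
Qed.

Lemma lyx_is_li_all :
  (forall c a : seq nat, c != [::] -> a != [::] -> (0 < sumn c + sumn a)%N ->
     lyx_is_li psi c a) <->
  (forall (c : seq nat) n, c != [::] -> (0 < sumn c + n)%N ->
     lyx_is_li psi c [:: n]) /\
  (forall a b : seq nat, is_index a -> is_index b -> (2 <= size b)%N ->
     ~~ all (pred1 1%N) (a ++ b) ->
     p5_eval (lyx a b) (psi_ijk psi 4 5 1 + psi_ijk psi 1 2 3) =
     p5_eval (lyx (rcons a (head 0%N b)) (behead b))
       (psi_ijk psi 4 5 1 + psi_ijk psi 1 2 3)).
Proof.
split=> [H|[H1 H2]].
  split=> [c n c0 s0|a b].
    by apply: H; rewrite //= addn0.
  have predE (s : seq nat) : all (leq 1) s ->
      exists s', s = [seq n.+1 | n <- s'].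
    elim: s => [|[//|n] s IH] /= s0; first by exists [::].
    by have [s' ->] := IH s0; exists (n :: s').
  move=> /andP[na /predE[c E]] /andP[_ /predE[d E']]; subst a b.
  case: d => [//|d1 [//|d2 d]] _ nz /=.
  rewrite -map_rcons -[[:: d2.+1 & _]]/[seq n.+1 | n <- d2 :: d].
  have c0 : c != [::] by case: (c) na.
  have s0 : (0 < sumn c + sumn [:: d1, d2 & d])%N.
    rewrite -sumn_cat lt0n; apply: contra nz => /eqP/sumn_eq0 E.
    by rewrite -map_cat E map_nseq; apply/all_pred1P; rewrite size_nseq.
  rewrite (@lyx_succ c [:: d1, d2 & d]) // lyx_succ; last first.
    by rewrite -size_eq0 size_rcons.
  rewrite (H c) // (H (rcons c d1)) ?cat_rcons // -?size_eq0 ?size_rcons //.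
  by move: s0; rewrite sumn_rcons /=; lia.
move=> c a; elim: a c => [//|a1 a IH] c c0 _ s0.
case: a IH s0 => [|a2 a] IH s0.
  by apply: H1 => //; move: s0; rewrite /= addn0.
have rc : rcons c a1 != [::] by rewrite -size_eq0 size_rcons.
rewrite /lyx_is_li.
have -> : lyx451 c [:: a1, a2 & a] psi = lyx451 (rcons c a1) (a2 :: a) psi.
  rewrite -!lyx_succ // map_rcons.
  apply: (H2 [seq n.+1 | n <- c] [seq n.+1 | n <- [:: a1, a2 & a]]) => //.
  - by rewrite /is_index all_succ andbT -size_eq0 size_map size_eq0.
  - by rewrite /is_index all_succ.
  apply: contraL s0; rewrite -map_cat all_map -leqNgt leqn0 -sumn_cat.
  by move=> /all_pred1P E; rewrite E sumn_nseq mul0n.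
rewrite -cat_rcons; apply: IH => //.
by move: s0; rewrite sumn_rcons /=; lia.
Qed.

End DepthReduction.

Theorem theoremC (k : fieldType) (char0 : [pchar k] =i pred0)
    (psi : ncps bool k) (skew_psi : Skew psi) :
  dmr0 psi <->
  (rc0 psi /\
   forall a b : seq nat,
     is_index a -> is_index b -> (2 <= size b)%N ->
     ~~ all (pred1 1%N) (a ++ b) ->
     p5_eval (lyx a b) (psi_ijk psi 4 5 1 + psi_ijk psi 1 2 3) =
     p5_eval (lyx (rcons a (head 0%N b)) (behead b))
       (psi_ijk psi 4 5 1 + psi_ijk psi 1 2 3)).
Proof.
have lie_psi := skew_lie skew_psi.
have gapP := iff_trans (rc_eq_gap char0 skew_psi) (gap_words char0 lie_psi).
have depth1P : rc_eq psi <-> forall (c : seq nat) n, c != [::] ->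
    (0 < sumn c + n)%N -> lyx_is_li psi c [:: n].
  by split=> [/gapP H c n c0 s0|H]; [|apply/gapP => c n c0 s0];
    apply/(lyx_is_li_gap lie_psi n c0); apply: H.
have rc0P : rc0 psi <-> rc_eq psi /\ psi [:: false; true] = 0.
  by split=> [[[_ ?] ?] | [? ?]].
rewrite (dmr0_stuf char0 lie_psi (skew_nseq char0 skew_psi)) rc0P depth1P.
rewrite (stuffle_lyx_is_li lie_psi) lyx_is_li_all; tauto.
Qed.
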